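(* Let $N,M$ be positive integers, let $D=\{(x_{ij})_{1\le i\le N,\,1\le j\le M} : x_{ij}\ge 0,\ \sum_{j=1}^M x_{ij}=1 \text{ for all } 1\le i\le N\}$, and let $P$ be a real-valued function that is twice continuously differentiable on an open set of $\mathbb{R}^{NM}$ containing $D$. Then there exist small enough fixed stepsizes $\epsilon_1,\dots,\epsilon_N>0$ such that the set of initial conditions $\mathbf{x}^0\in D$ for which the MWU dynamics $(\mathbf{x}^t)_{t\ge 0}$ with objective $P$ and stepsizes $\epsilon_1,\dots,\epsilon_N$ converges to a fixed point that violates the second order KKT conditions (i.e. to a fixed point that is not a second order stationary point) has Lebesgue measure zero in $D$.
   Context: The problem considered is $\max_{\mathbf{x}\in D}P(\mathbf{x})$. MWU dynamics: for stepsizes $\epsilon_1,\dots,\epsilon_N>0$ small enough that the numerators and denominators below are positive on $D$, the update rule $T:D\to D$, $\mathbf{x}^{t+1}=T(\mathbf{x}^t)$, is $$x_{ij}^{t+1}=x_{ij}^t\,\frac{1+\epsilon_i\frac{\partial P}{\partial x_{ij}}(\mathbf{x}^t)}{1+\epsilon_i\sum_{s=1}^M x_{is}^t\frac{\partial P}{\partial x_{is}}(\mathbf{x}^t)}.$$ A fixed point is a point $\mathbf{y}\in D$ with $T(\mathbf{y})=\mathbf{y}$. Stationary point (first order KKT): $\mathbf{x}^*\in D$ such that for all $i,j$: if $x^*_{ij}>0$ then $\frac{\partial P}{\partial x_{ij}}(\mathbf{x}^* )=\sum_{j'}x^*_{ij'}\frac{\partial P}{\partial x_{ij'}}(\mathbf{x}^*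 )$, and if $x^*_{ij}=0$ then $\frac{\partial P}{\partial x_{ij}}(\mathbf{x}^* )\le\sum_{j'}x^*_{ij'}\frac{\partial P}{\partial x_{ij'}}(\mathbf{x}^* )$. Second order stationary point (second order KKT): a stationary point $\mathbf{x}^*$ such that $\mathbf{y}^\top\nabla^2P(\mathbf{x}^* )\mathbf{y}\le 0$ for all $\mathbf{y}\in\mathbb{R}^{NM}$ with $\sum_{j=1}^M y_{ij}=0$ for every $i$ and $y_{ij}=0$ whenever $x^*_{ij}=0$. Lebesgue measure on $D$ means the $N(M-1)$-dimensional Lebesgue measure on the affine hull of $D$ (equivalently, the Lebesgue measure after eliminating one variable $x_{ij}$ for each $i$). *)

(* Defs.v *)
From HB Require Import structures.
From mathcomp Require Import all_boot all_order all_algebra.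
From mathcomp Require Import all_classical all_reals all_analysis.

Set Implicit Arguments.
Unset Strict Implicit.
Unset Printing Implicit Defensive.

Import Order.TTheory GRing.Theory Num.Theory.
Import numFieldNormedType.Exports.

Local Open Scope classical_set_scope.
Local Open Scope ring_scope.

Definition product_simplex (R : realType) (N M : nat) : set 'M[R]_(N, M) :=
  [set x | (forall i j, 0 <= x i j) /\ (forall i, \sum_(j < M) x i j = 1)].
Arguments product_simplex : clear implicits.

Definition partial (R : realType) (N M : nat) (i : 'I_N) (j : 'I_M)
    (f : 'M[R]_(N, M) -> R) : 'M[R]_(N, M) -> R :=
  fun x => 'D_(delta_mx i j) f x.

(* Meant for open U: continuity is that of the ambient space at points of U. *)
Definition C1_on (R : realType) (N M : nat) (U : set 'M[R]_(N, M))
    (f : 'M[R]_(N, M) -> R) : Prop :=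
  forall x, U x -> forall i j,
    derivable f x (delta_mx i j) /\ {for x, continuous (partial i j f)}.

Definition C2_on (R : realType) (N M : nat) (U : set 'M[R]_(N, M))
    (f : 'M[R]_(N, M) -> R) : Prop :=
  C1_on U f /\ forall i j, C1_on U (partial i j f).

Definition avg_partial (R : realType) (N M : nat) (P : 'M[R]_(N, M) -> R)
    (x : 'M[R]_(N, M)) (i : 'I_N) : R :=
  \sum_(s < M) x i s * partial i s P x.

Definition mwu (R : realType) (N M : nat) (P : 'M[R]_(N, M) -> R)
    (eps : 'I_N -> R) (x : 'M[R]_(N, M)) : 'M[R]_(N, M) :=
  \matrix_(i, j) (x i j * ((1 + eps i * partial i j P x) /
                           (1 + eps i * avg_partial P x i))).

Definition admissible_stepsizes (R : realType) (N M : nat)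
    (P : 'M[R]_(N, M) -> R) (eps : 'I_N -> R) : Prop :=
  (forall i, 0 < eps i) /\
  forall x, product_simplex R N M x -> forall i,
    (forall j, 0 < 1 + eps i * partial i j P x) /\
    0 < 1 + eps i * avg_partial P x i.

Definition stationary (R : realType) (N M : nat) (P : 'M[R]_(N, M) -> R)
    (x : 'M[R]_(N, M)) : Prop :=
  [/\ product_simplex R N M x,
      forall i j, 0 < x i j -> partial i j P x = avg_partial P x i
    & forall i j, x i j = 0 -> partial i j P x <= avg_partial P x i].

Definition hessian_form (R : realType) (N M : nat) (P : 'M[R]_(N, M) -> R)
    (x y : 'M[R]_(N, M)) : R :=
  \sum_(i < N) \sum_(j < M) \sum_(k < N) \sum_(l < M)
    y i j * partial i j (partial k l P) x * y k l.

Definition second_order_stationary (R : realType) (N M : nat)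
    (P : 'M[R]_(N, M) -> R) (x : 'M[R]_(N, M)) : Prop :=
  stationary P x /\
  forall y : 'M[R]_(N, M),
    (forall i, \sum_(j < M) y i j = 0) ->
    (forall i j, x i j = 0 -> y i j = 0) ->
    hessian_form P x y <= 0.

Definition box (R : realType) (m n : nat) (a b : 'M[R]_(m, n)) :
    set 'M[R]_(m, n) :=
  [set x | forall i j, a i j <= x i j <= b i j].

Definition box_volume (R : realType) (m n : nat) (a b : 'M[R]_(m, n)) : R :=
  \prod_(i < m) \prod_(j < n) Num.max 0 (b i j - a i j).

(* Lebesgue outer measure on R^(m * n): infimum of the total volume over the
   countable coverings by boxes. Coverings are indexed by an arbitrary K, possibly
   finite or empty, because in dimension 0 every box has volume 1; there the
   definition gives 0 on the empty set and 1 on the point. *)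
Definition lebesgue_outer (R : realType) (m n : nat) (A : set 'M[R]_(m, n)) :
    \bar R :=
  ereal_inf [set v | exists (K : set nat) (a b : nat -> 'M[R]_(m, n)),
    A `<=` \bigcup_(k in K) box (a k) (b k) /\
    v = (\esum_(k in K) (box_volume (a k) (b k))%:E)%E].

(* Drops the coordinate x i (c i) of each row. *)
Definition eliminate (R : realType) (N M : nat) (c : 'I_N -> 'I_M)
    (x : 'M[R]_(N, M)) : 'M[R]_(N, M.-1) :=
  \matrix_(i, j) x i (lift (c i) j).

(* N(M-1)-dimensional Lebesgue measure zero, for S contained in the product of
   simplices (where [eliminate c] is injective). All choices of eliminated
   coordinates c give the same measure; for M = 0 there is no c. A set of outer
   measure zero is automatically Lebesgue measurable. *)
Definition null_in_simplex (R : realType) (N M : nat) (S : set 'M[R]_(N, M)) :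
    Prop :=
  forall c : 'I_N -> 'I_M, lebesgue_outer (eliminate c @` S) = 0%E.

Definition bad_initial_conditions (R : realType) (N M : nat)
    (P : 'M[R]_(N, M) -> R) (eps : 'I_N -> R) : set 'M[R]_(N, M) :=
  [set x0 | product_simplex R N M x0 /\
    exists y, [/\ product_simplex R N M y, mwu P eps y = y,
      ~ second_order_stationary P y
      & (fun t : nat => iter t (mwu P eps) x0) @ \oo --> y]].

(* Main.v *)
Require Import Defs.
From HB Require Import structures.
From mathcomp Require Import all_boot all_order all_algebra.
From mathcomp Require Import all_classical all_reals all_analysis.
From mathcomp Require Import ring lra.

(** For small stepsizes the map T is close to the identity in C^1, hence
    |Tx - Tx'| >= |x - x'| / 2 locally, and preimages of null sets are null. It
    therefore suffices that, for each fixed point y which is not second order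
    stationary, the points of the simplex whose whole orbit stays near y form a null
    set; countably many rational balls then cover all y. If y is not
    stationary, a coordinate vanishing at y grows geometrically, so those points lie in
    a face. If y is stationary, there is a quadratic form q, positive somewhere, with
    q(Tx - Tx') >= lambda q(x - x') near y for some lambda > 1. Orbits being bounded,
    q(x - x') <= 0 for any two points x, x' staying near y: these points form a
    Lipschitz graph over a hyperplane. *)

Set Implicit Arguments.
Unset Strict Implicit.
Unset Printing Implicit Defensive.

Import Order.TTheory GRing.Theory Num.Theory.
Import numFieldNormedType.Exports.

Local Open Scope classical_set_scope.
Local Open Scope ring_scope.

(** * Null sets *)

(** A bad fixed point may be degenerate, non-isolated and on the boundary, with T only C^1; the form
    q asks for no spectral splitting and no invariant manifold. Its origin: at a stationary y, the
    Jacobian along the face of y is J = 1 + S with S self-adjoint for a weighted inner product. With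
    A = S - d and q(u) = <u, A u>, one gets q(J u) = (1 + d)^2 q(u) + 2 (1 + d) |A u|^2 + <A u, A A
    u>, and the last two terms sum to at least |A u|^2 because 1 + S >= 0 for small stepsizes.
    Taking d > 0 outside the spectrum of S makes |A u|^2 a strict margin, which absorbs the
    nonlinear error; taking d below the Rayleigh quotient of the bad direction keeps q positive
    there. Entries vanishing at y are multiplied by factors that the KKT inequality bounds by 1 but
    not away from 1, so no contraction is available. Subtracting a large multiple of their squares
    still works: lambda > 1 turns mere non-increase into a gain. Strict differentiability is the
    right notion because two moving orbits are compared, not an orbit with y. *)

Lemma mx_coord_le (R : realType) (m n : nat) (v : 'M[R]_(m, n)) i j :
  `|v i j| <= `|v|.
Proof.
by rewrite [leRHS]/Num.norm /= mx_normrE; apply/bigmax_geP; right => /=; exists (i, j).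
Qed.

Lemma mx_norm_leP (R : realType) (m n : nat) (v : 'M[R]_(m, n)) (C : R) :
  0 <= C -> (forall i j, `|v i j| <= C) -> `|v| <= C.
Proof.
by move=> C0 h; rewrite [leLHS]/Num.norm /= mx_normrE; apply/bigmax_leP; split => // -[i j] _.
Qed.

Lemma ler_sum_uniq_sub (R : numDomainType) (I : eqType) (s t : seq I) (F : I -> R) :
  uniq s -> uniq t -> {subset s <= t} -> (forall i, 0 <= F i) ->
  \sum_(i <- s) F i <= \sum_(i <- t) F i.
Proof.
move=> us ut st F0; rewrite [leRHS](bigID (mem s)) /= -[leLHS]addr0 lerD //.
  rewrite -[leRHS]big_filter; suff p : perm_eq [seq i <- t | i \in s] s.
    by rewrite (perm_big _ p).
  apply: uniq_perm; rewrite ?filter_uniq // => i; rewrite mem_filter /=.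
  by case: (boolP (i \in s)) => //= /st ->.
exact: sumr_ge0.
Qed.

(* d-dimensional Hausdorff measure zero, for the sup norm. *)
Definition hnull (R : realType) (m n d : nat) (A : set 'M[R]_(m, n)) : Prop :=
  forall e : R, 0 < e -> exists (a : nat -> 'M[R]_(m, n)) (r : nat -> R),
    [/\ forall k, 0 <= r k, forall x, A x -> exists k, `|x - a k| <= r k
      & forall l, \sum_(k < l) r k ^+ d <= e].

Section Hnull.
Variables (R : realType) (d : nat).
Hypothesis d0 : (0 < d)%N.

Lemma hnull_sub m n (A B : set 'M[R]_(m, n)) : A `<=` B -> hnull d B -> hnull d A.
Proof.
by move=> AB hB e /hB[a [r [r0 cov sm]]]; exists a, r; split=> // x /AB /cov.
Qed.

(** Any countable family of balls is reindexed by [pickle]; a number that encodes no index gets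
    radius 0, which costs nothing because d > 0. *)
Lemma hnull_cover m n (A : set 'M[R]_(m, n)) :
  (forall e : R, 0 < e -> exists (I : countType) (a : I -> 'M[R]_(m, n)) (r : I -> R),
    [/\ forall k, 0 <= r k, forall x, A x -> exists k, `|x - a k| <= r k
      & forall s : seq I, uniq s -> \sum_(k <- s) r k ^+ d <= e]) ->
  hnull d A.
Proof.
move=> h e /h[I [a [r [r0 cov sm]]]].
exists (fun k => oapp a 0 (pickle_inv k)), (fun k => oapp r 0 (pickle_inv k)).
split=> [k|x /cov[i xi]|l]; first by case: pickle_inv => /=.
  by exists (pickle i); rewrite pickleK_inv.
have -> : \sum_(k < l) oapp r 0 (pickle_inv k) ^+ d =
    \sum_(i <- pmap (@pickle_inv I) (iota 0 l)) r i ^+ d.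
  rewrite big_pmap -(big_mkord xpredT (fun k => oapp r 0 (pickle_inv k) ^+ d)).
  rewrite /index_iota subn0; apply: eq_bigr => k _.
  by case: (pickle_inv k) => //=; rewrite expr0n gtn_eqF.
apply: sm; apply: pmap_uniq (iota_uniq _ _); exact: pickle_invK.
Qed.

Lemma sum_halves_le (J : countType) (s : seq J) (e : R) : 0 <= e -> uniq s ->
  \sum_(j <- s) e / 2 ^+ (pickle j).+1 <= e.
Proof.
move=> e0 us.
have key l : \sum_(k < l) e / 2 ^+ k.+1 = e - e / 2 ^+ l.
  elim: l => [|l ih]; first by rewrite big_ord0 expr0 divr1 subrr.
  rewrite big_ord_recr /= ih exprS; field.
  by rewrite expf_neq0.
pose l := (\max_(j <- s) pickle j).+1.
have -> : \sum_(j <- s) e / 2 ^+ (pickle j).+1 =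
    \sum_(k <- map pickle s) e / 2 ^+ k.+1 by rewrite big_map.
apply: (@le_trans _ _ (\sum_(k <- iota 0 l) e / 2 ^+ k.+1)).
  apply: ler_sum_uniq_sub; rewrite ?iota_uniq ?map_inj_uniq //.
  - move=> _ /mapP[j js ->]; rewrite mem_iota /= add0n ltnS.
    exact: (leq_bigmax_seq (F := pickle)).
  - by move=> k; rewrite divr_ge0 // exprn_ge0.
have -> : \sum_(k <- iota 0 l) e / 2 ^+ k.+1 = \sum_(k < l) e / 2 ^+ k.+1.
  by rewrite -(big_mkord xpredT (fun k => e / 2 ^+ k.+1)) /index_iota subn0.
by rewrite key gerBl divr_ge0 // exprn_ge0.
Qed.

Lemma hnull_bigcup m n (J : countType) (A : J -> set 'M[R]_(m, n)) :
  (forall j, hnull d (A j)) -> hnull d (\bigcup_j A j).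
Proof.
move=> hA; apply: hnull_cover => e e0.
have h j : exists ar : (nat -> 'M[R]_(m, n)) * (nat -> R),
    [/\ forall k, 0 <= ar.2 k, forall x, A j x -> exists k, `|x - ar.1 k| <= ar.2 k
      & forall l, \sum_(k < l) ar.2 k ^+ d <= e / 2 ^+ (pickle j).+1].
  have [|a [r H]] := hA j (e / 2 ^+ (pickle j).+1); last by exists (a, r).
  by rewrite divr_gt0 // exprn_gt0.
have [ar har] := choice h.
exists (J * nat)%type, (fun p => (ar p.1).1 p.2), (fun p => (ar p.1).2 p.2).
split=> [[j k]|x [j _ /=]|s us]; first by have [+ _ _] := har j; apply.
  by have [_ + _] := har j; move=> /(_ x) /[apply] -[k xk]; exists (j, k).
have [l sl] : exists l, forall p, p \in s -> (p.2 < l)%N.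
  exists (\max_(p <- s) p.2).+1 => p ps; rewrite ltnS.
  exact: (leq_bigmax_seq (F := fun p : J * nat => p.2)).
pose js := undup (map fst s).
(* The finite set of pairs is enlarged to a rectangle, so that each row can be bounded by its share
   of e. *)
apply: (@le_trans _ _ (\sum_(p <- [seq (j, k) | j <- js, k <- iota 0 l]) (ar p.1).2 p.2 ^+ d)).
  apply: ler_sum_uniq_sub => //.
  - by apply: allpairs_uniq; rewrite ?undup_uniq ?iota_uniq //; move=> [? ?] [? ?] _ _ [-> ->].
  - move=> [j k] jks; apply/allpairsP; exists (j, k); split=> //=.
      by rewrite mem_undup; apply/mapP; exists (j, k).
    by rewrite mem_iota /= add0n; apply: (sl (j, k)).
  - by move=> [j k]; apply: exprn_ge0; have [+ _ _] := har j; apply.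
rewrite big_allpairs_dep /=; apply: le_trans (sum_halves_le (ltW e0) (undup_uniq (map fst s))).
apply: ler_sum => j _; have [_ _ /(_ l)] := har j; congr (_ <= _).
by rewrite -(big_mkord xpredT (fun k => (ar j).2 k ^+ d)) /index_iota subn0.
Qed.

(** Balls covering Z are pulled back to A. Their centres need not be images of points of A, so each
    is replaced by a point of A that f sends into the ball, whence the factor 2 in the new
    radius. *)
Lemma hnull_lipschitz m n m' n' (A : set 'M[R]_(m, n)) (Z : set 'M[R]_(m', n'))
    (f : 'M[R]_(m, n) -> 'M[R]_(m', n')) (C : R) :
  hnull d Z -> (forall x, A x -> Z (f x)) ->
  (forall x x', A x -> A x' -> `|x - x'| <= C * `|f x - f x'|) -> hnull d A.
Proof.
move=> hZ AZ lip e e0.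
(* C may be negative or zero; the maximum and the + 1 keep the scaling factor positive. *)
pose K := (Num.max C 0 * 2 + 1) ^+ d.
have C0 : 0 <= Num.max C 0 by rewrite le_max lexx orbT.
have K0 : 0 < K by apply: exprn_gt0; rewrite ltr_wpDl // mulr_ge0.
have [|b [r [r0 cov sm]]] := hZ (e / K); first by rewrite divr_gt0.
pose Q k := [set x | A x /\ `|f x - b k| <= r k].
exists (fun k => xget 0 (Q k)), (fun k => (Num.max C 0 * 2 + 1) * r k).
split=> [k|x Ax|l].
- by rewrite mulr_ge0 // addr_ge0 // mulr_ge0.
- have [k xk] := cov _ (AZ x Ax); exists k.
  have [Aq qk] : Q k (xget 0 (Q k)) by apply: xgetPex; exists x.
  apply: le_trans (lip _ _ Ax Aq) _.
  have h : `|f x - f (xget 0 (Q k))| <= r k + r k.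
    apply: le_trans (ler_distD (b k) _ _) _; apply: lerD => //.
    by rewrite distrC.
  apply: (@le_trans _ _ (Num.max C 0 * (r k + r k))).
    apply: (@le_trans _ _ (Num.max C 0 * `|f x - f (xget 0 (Q k))|)).
      by apply: ler_wpM2r => //; rewrite le_max lexx.
    exact: ler_wpM2l.
  by rewrite -mulr2n -mulr_natr; have := r0 k; nra.
- under eq_bigr do rewrite exprMn; rewrite -mulr_sumr -ler_pdivlMl //.
  by rewrite mulrC; apply: sm.
Qed.

(** The Lipschitz bound on f is exactly the lower bound that [hnull_lipschitz] asks of a right
    inverse of f. *)
Lemma hnull_image m n m' n' (Z : set 'M[R]_(m', n'))
    (f : 'M[R]_(m', n') -> 'M[R]_(m, n)) (C : R) :
  hnull d Z -> 
  (forall x x', Z x -> Z x' -> `|f x - f x'| <= C * `|x - x'|) -> hnull d (f @` Z).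
Proof.
move=> hZ lip.
pose g x := xget 0 [set z | Z z /\ f z = x].
have gP x : (f @` Z) x -> Z (g x) /\ f (g x) = x.
  by move=> [z Zz zx]; apply: (@xgetPex _ 0 [set z | Z z /\ f z = x]); exists z.
apply: (@hnull_lipschitz _ _ _ _ _ Z g C hZ) => [x /gP[] //|x x' /gP[h1 h2] /gP[h3 h4]].
by rewrite -{1}h2 -{1}h4; apply: lip.
Qed.

End Hnull.

Lemma grid_index (R : realType) (l : nat) (L u : R) : 0 < L -> 0 <= u < L ->
  exists k : 'I_l.+1, k%:R * (L / l.+1%:R) <= u < k.+1%:R * (L / l.+1%:R).
Proof.
move=> L0 /andP[u0 uL].
have h0 : 0 < L / l.+1%:R by rewrite divr_gt0.
have q0 : 0 <= u / (L / l.+1%:R) by rewrite divr_ge0 // ltW.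
have /andP[lo hi] := truncn_itv q0.
have kl : (Num.trunc (u / (L / l.+1%:R)) < l.+1)%N.
  rewrite -(ltr_nat R); apply: le_lt_trans lo _.
  by rewrite ltr_pdivrMr // mulrCA divff ?mulr1 // pnatr_eq0.
exists (Ordinal kl) => /=.
by rewrite -ler_pdivlMr // -ltr_pdivrMr // lo hi.
Qed.

(* Projecting along [e] onto a coordinate hyperplane is bi-Lipschitz on A, and a
   bounded subset of that hyperplane is covered by [(l+1)^(m*n-1)] balls of radius
   O(1/(l+1)). *)
Lemma hnull_cone (R : realType) (m n : nat) (A : set 'M[R]_(m, n))
    (e : 'M[R]_(m, n)) (i0 : 'I_m) (j0 : 'I_n) (B C : R) :
  e i0 j0 != 0 -> (forall x, A x -> `|x| <= B) ->
  (forall x x' t, A x -> A x' -> `|t| <= C * `|x - x' - t *: e|) ->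
  hnull (m * n) A.
Proof.
move=> e0 AB cone.
have mn0 : (0 < m * n)%N.
  by rewrite muln_gt0 (leq_ltn_trans _ (ltn_ord i0)) ?(leq_ltn_trans _ (ltn_ord j0)).
have [[x0 Ax0]|A0] := pselect (exists x, A x); last first.
  move=> eps eps0; exists (fun=> 0), (fun=> 0); split=> // [x Ax|l].
    by case: A0; exists x.
  by rewrite big1 ?ltW // => k _; rewrite expr0n gtn_eqF.
have B0 : 0 <= B by apply: le_trans (AB _ Ax0).
pose T (x : 'M[R]_(m, n)) := x i0 j0 / e i0 j0.
pose w x := x - T x *: e.
pose B1 := B + B / `|e i0 j0| * `|e|.
have B10 : 0 <= B1 by rewrite addr_ge0 // mulr_ge0 // divr_ge0.
have wB x : A x -> `|w x| <= B1.
  move=> Ax; apply: le_trans (ler_normB _ _) _; apply: lerD; first exact: AB.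
  rewrite normrZ ler_wpM2r // /T normrM normfV ler_wpM2r ?invr_ge0 //.
  exact: le_trans (mx_coord_le _ _ _) (AB _ Ax).
have wD x x' : w x - w x' = x - x' - (T x - T x') *: e.
  by rewrite /w scalerBl !opprD !opprK addrACA.
have C0 : 0 <= Num.max C 0 by rewrite le_max lexx orbT.
pose C1 := 1 + Num.max C 0 * `|e|.
have C10 : 0 < C1 by rewrite ltr_wpDr // mulr_ge0.
have lip x x' : A x -> A x' -> `|x - x'| <= C1 * `|w x - w x'|.
  move=> Ax Ax'.
  have h := cone x x' (T x - T x') Ax Ax'; rewrite -wD in h.
  have -> : x - x' = w x - w x' + (T x - T x') *: e by rewrite wD subrK.
  apply: le_trans (ler_normD _ _) _; rewrite mulrDl mul1r lerD2l normrZ mulrAC.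
  rewrite ler_wpM2r //; apply: le_trans h _; apply: ler_wpM2r => //.
  by rewrite le_max lexx.
(* Entries of [w x], shifted by B1, lie in [0, 2 B1]; the + 1 puts them inside the half-open
   interval [0, L). *)
pose L := 2 * B1 + 1.
have L0 : 0 < L by rewrite /L; lra.
pose K := {ij : 'I_m * 'I_n | ij != (i0, j0)}.
have cardK : #|{: K}| = (m * n).-1.
  rewrite card_sig; have := cardC1 (i0, j0); rewrite card_prod !card_ord => <-.
  exact: eq_card.
apply: hnull_cover => // eps eps0.
(* The total cost of (l+1)^(mn-1) balls of radius C1 L / (l+1) is Q / (l+1), which dictates l. *)
pose Q := (C1 * L) ^+ (m * n).
have Q0 : 0 <= Q by apply: exprn_ge0; apply: mulr_ge0; apply: ltW.
pose l := Num.trunc (Q / eps).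
have lP : Q / l.+1%:R <= eps.
  rewrite ler_pdivrMr // mulrC -ler_pdivrMr //.
  have /truncn_itv/andP[_ /ltW //] : 0 <= Q / eps by rewrite divr_ge0 // ltW.
pose h := L / l.+1%:R.
have h0 : 0 < h by apply: divr_gt0.
pose cell (s : {ffun K -> 'I_l.+1}) := [set x | A x /\
  forall k : K, (s k)%:R * h <= w x (val k).1 (val k).2 + B1 < (s k).+1%:R * h].
exists {ffun K -> 'I_l.+1}, (fun s => xget 0 (cell s)), (fun=> C1 * h); split.
- by move=> _; apply: mulr_ge0; apply: ltW.
- move=> x Ax.
  have ex (k : K) : exists s : 'I_l.+1,
      s%:R * h <= w x (val k).1 (val k).2 + B1 < s.+1%:R * h.
    apply: grid_index => //; have := wB _ Ax.
    move=> /(le_trans (mx_coord_le _ (val k).1 (val k).2)).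
    by rewrite ler_norml /L => /andP[? ?]; apply/andP; split; lra.
  have [s sP] := choice ex.
  have xs : cell (finfun s) x by split=> // k; rewrite ffunE.
  exists (finfun s).
  have [Ay ys] : cell (finfun s) (xget 0 (cell (finfun s))) by apply: xgetPex; exists x.
  apply: le_trans (lip _ _ Ax Ay) _; rewrite ler_pM2l //.
  apply: mx_norm_leP => [|i j]; first exact: ltW.
  have [ij|ij] := eqVneq (i, j) (i0, j0).
    by case: ij => -> ->; rewrite wD !mxE /T -mulrBl divfK // subrr normr0 ltW.
  have := ys (exist _ (i, j) ij); have := sP (exist _ (i, j) ij).
  rewrite ffunE /= !mxE => /andP[h1 h2] /andP[h3 h4].
  by rewrite -natr1 mulrDl mul1r in h2 h4; rewrite ler_norml; apply/andP; split; lra.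
- move=> s us; apply: (@le_trans _ _ (\sum_(k : {ffun K -> 'I_l.+1}) (C1 * h) ^+ (m * n))).
    apply: (@ler_sum_uniq_sub _ _ _ (index_enum _) (fun=> (C1 * h) ^+ (m * n))) => //.
    + exact: index_enum_uniq.
    + by move=> _; apply: exprn_ge0; apply: mulr_ge0; apply: ltW.
  rewrite sumr_const card_ffun cardK card_ord; apply: le_trans lP.
  rewrite /h mulrA expr_div_n -/Q -[leLHS]mulr_natr natrX.
  rewrite -{1}(prednK mn0) exprS invfM -!mulrA mulVf ?mulr1 //.
Qed.


Lemma lebesgue_outer_ge0 (R : realType) (m n : nat) (A : set 'M[R]_(m, n)) :
  (0 <= lebesgue_outer A)%E.
Proof.
apply: le_ereal_inf_tmp => v [K [a [b [_ ->]]]]; apply: esum_ge0 => k _.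
rewrite lee_fin /box_volume; apply: prodr_ge0 => i _; apply: prodr_ge0 => j _.
by rewrite le_max lexx.
Qed.

(** The covering by no box is taken: in dimension 0, the case M = 1, even one box would cost 1. *)
Lemma lebesgue_outer_set0 (R : realType) (m n : nat) :
  lebesgue_outer (set0 : set 'M[R]_(m, n)) = 0%E.
Proof.
apply/eqP; rewrite eq_le lebesgue_outer_ge0 andbT; apply: ereal_inf_lbound.
exists set0, (fun=> 0), (fun=> 0); split=> //.
by rewrite esum_set0.
Qed.

Lemma lebesgue_outer_hnull (R : realType) (m n : nat) (A : set 'M[R]_(m, n)) :
  hnull (m * n) A -> lebesgue_outer A = 0%E.
Proof.
move=> hA; apply/eqP; rewrite eq_le lebesgue_outer_ge0 andbT.
apply/lee_addgt0Pr => e e0; rewrite add0e.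
(* A ball of radius r is a cube of volume (2 r)^(mn), hence the division of e. *)
have [|a [r [r0 cov sm]]] := hA (e / 2 ^+ (m * n)); first by rewrite divr_gt0 // exprn_gt0.
pose lo k : 'M[R]_(m, n) := a k - const_mx (r k).
pose hi k : 'M[R]_(m, n) := a k + const_mx (r k).
have vol k : box_volume (lo k) (hi k) = 2 ^+ (m * n) * r k ^+ (m * n).
  rewrite /box_volume (eq_bigr (fun=> (2 * r k) ^+ n)) => [|i _].
    by rewrite prodr_const card_ord -exprM -exprMn mulnC.
  rewrite (eq_bigr (fun=> 2 * r k)) => [|j _]; first by rewrite prodr_const card_ord.
  by rewrite !mxE max_r; have := r0 k; [lra|move=> ?; lra].
apply: (@le_trans _ _ (\esum_(k in [set: nat]) (box_volume (lo k) (hi k))%:E)%E).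
  apply: ereal_inf_lbound; exists setT, lo, hi; split=> // x /cov[k xk].
  exists k => // i j; have := le_trans (mx_coord_le _ i j) xk.
  by rewrite !mxE ler_norml => /andP[? ?]; apply/andP; split; lra.
have v0 k : (0 <= (box_volume (lo k) (hi k))%:E)%E.
  by rewrite lee_fin vol mulr_ge0 // exprn_ge0.
rewrite -nneseries_esumT //; apply: lime_le; first exact: is_cvg_nneseries.
apply: nearW => l; rewrite sumEFin lee_fin big_mkord.
under eq_bigr do rewrite vol.
rewrite -mulr_sumr mulrC -ler_pdivlMr; first exact: sm.
by rewrite exprn_gt0.
Qed.

(** * Tangent directions and null subsets of the simplex *)

Section Simplex.
Variables (R : realType) (N M : nat).
Implicit Types (x v : 'M[R]_(N, M)).

Definition tangent v := forall i, \sum_(j < M) v i j = 0.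

Lemma tangentB x x' : product_simplex R N M x -> product_simplex R N M x' ->
  tangent (x - x').
Proof.
move=> [_ sx] [_ sx'] i; under eq_bigr do rewrite !mxE.
by rewrite sumrB sx sx' subrr.
Qed.

Lemma tangentZ (a : R) v : tangent v -> tangent (a *: v).
Proof.
move=> h i; under eq_bigr do rewrite mxE.
by rewrite -mulr_sumr h mulr0.
Qed.

Lemma tangentD v v' : tangent v -> tangent v' -> tangent (v + v').
Proof.
move=> h h' i; under eq_bigr do rewrite mxE.
by rewrite big_split /= h h' addr0.
Qed.

Lemma simplex_le1 x i j : product_simplex R N M x -> x i j <= 1.
Proof.
by move=> [x0 sx]; rewrite -(sx i) (bigD1 j) //= lerDl sumr_ge0.
Qed.

Lemma simplex_norm_le1 x : product_simplex R N M x -> `|x| <= 1.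
Proof.
move=> Dx; apply: mx_norm_leP => // i j; rewrite ger0_norm ?simplex_le1 //.
by have [+ _] := Dx; apply.
Qed.

Variable c : 'I_N -> 'I_M.

Lemma eliminateB x x' : eliminate c (x - x') = eliminate c x - eliminate c x'.
Proof. by apply/matrixP => i j; rewrite !mxE. Qed.

Lemma eliminateZ (a : R) x : eliminate c (a *: x) = a *: eliminate c x.
Proof. by apply/matrixP => i j; rewrite !mxE. Qed.

Lemma eliminate_norm_le v : `|eliminate c v| <= `|v|.
Proof. by apply: mx_norm_leP => // i j; rewrite mxE; apply: mx_coord_le. Qed.

End Simplex.

(** In a row of sum zero the dropped entry is minus the sum of the others. With [eliminate_norm_le],
    this makes [eliminate c] bi-Lipschitz on the simplex. *)
Lemma norm_le_eliminate (R : realType) (N M : nat) (c : 'I_N -> 'I_M) (v : 'M[R]_(N, M)) :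
  tangent v -> `|v| <= M%:R * `|eliminate c v|.
Proof.
case: M c v => [|M] c v tv.
  by rewrite mul0r; apply: mx_norm_leP => // i [].
apply: mx_norm_leP => [|i j]; first by rewrite mulr_ge0.
have co k : `|v i (lift (c i) k)| <= `|eliminate c v|.
  by have := mx_coord_le (eliminate c v) i k; rewrite mxE.
case: (unliftP (c i) j) => [k ->|->].
  by apply: le_trans (co k) _; rewrite -natr1 mulrDl mul1r lerDr mulr_ge0.
have -> : v i (c i) = - \sum_(k < M) v i (lift (c i) k).
  by have := tv i; rewrite (bigD1_ord (c i)) //= => /eqP; rewrite addr_eq0 => /eqP.
rewrite normrN; apply: le_trans (ler_norm_sum _ _ _) _.
apply: (@le_trans _ _ (\sum_(k < M) `|eliminate c v|)); first exact: ler_sum.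
by rewrite sumr_const card_ord -[leLHS]mulr_natl ler_wpM2r // ler_nat.
Qed.

(** The last hypothesis keeps differences of points of S away from the line spanned by e, so S is a
    Lipschitz graph in that direction. Dropping one entry per row makes the setting
    full-dimensional, where [hnull_cone] applies; [norm_le_eliminate] carries the result back. *)
Lemma hnull_simplex_cone (R : realType) (N M : nat) (S : set 'M[R]_(N, M))
    (e : 'M[R]_(N, M)) (C : R) : (0 < M)%N ->
  S `<=` product_simplex R N M -> tangent e -> e != 0 -> 0 <= C ->
  (forall x x' t, S x -> S x' -> `|t| <= C * `|x - x' - t *: e|) ->
  hnull (N * M.-1) S.
Proof.
move=> M0 SD te e0 C0 cone.
pose c (_ : 'I_N) := Ordinal M0.
(* Tangency of e prevents the elimination from killing it. *)
have : exists i j, eliminate c e i j != 0.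
  apply: contrapT => H; case/negP: e0; rewrite -normr_le0.
  apply: le_trans (norm_le_eliminate c te) _.
  suff -> : eliminate c e = 0 by rewrite normr0 mulr0.
  apply/matrixP => i j; apply/eqP; rewrite [X in _ == X]mxE; apply/negPn/negP => h.
  by apply: H; exists i, j.
move=> [i [j eij]].
have hA : hnull (N * M.-1) (eliminate c @` S).
  apply: (@hnull_cone _ _ _ _ _ i j 1 (C * M%:R) eij).
    move=> _ [x Sx <-]; apply: le_trans (eliminate_norm_le _ _) _.
    exact/simplex_norm_le1/SD.
  move=> _ _ t [x Sx <-] [x' Sx' <-]; apply: le_trans (cone _ _ t Sx Sx') _.
  rewrite -mulrA ler_wpM2l // -eliminateB -eliminateZ -eliminateB.
  apply: norm_le_eliminate; rewrite -scaleNr.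
  by apply: tangentD; [apply: tangentB; apply: SD|apply: tangentZ].
apply: (hnull_lipschitz (f := eliminate c) (C := M%:R) hA).
  by move=> x Sx; exists x.
move=> x x' Sx Sx'; rewrite -eliminateB; apply: norm_le_eliminate.
by apply: tangentB; apply: SD.
Qed.

(** [hnull] is stated on the simplex itself, hence independent of c, and every [eliminate c] is
    1-Lipschitz. *)
Lemma hnull_null_in_simplex (R : realType) (N M : nat) (S : set 'M[R]_(N, M)) :
  hnull (N * M.-1) S -> null_in_simplex S.
Proof.
move=> hS c; apply: lebesgue_outer_hnull.
apply: (hnull_image (C := 1) hS) => x x' _ _.
by rewrite mul1r -eliminateB; apply: eliminate_norm_le.
Qed.

Lemma sum_delta_mx (R : pzRingType) (m n : nat) (i i' : 'I_m) (j : 'I_n) :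
  \sum_(k < n) (delta_mx i j : 'M[R]_(m, n)) i' k = (i' == i)%:R.
Proof.
rewrite (bigD1 j) //= mxE eqxx andbT big1 ?addr0 // => k kj.
by rewrite mxE (negbTE kj) andbF.
Qed.

(** Moving mass from a second column k0 to j is a direction transversal to the face: entry (i, j) of
    x - x' - t e is just - t. *)
Lemma hnull_simplex_face (R : realType) (N M : nat) (i : 'I_N) (j : 'I_M) :
  (1 < M)%N -> hnull (N * M.-1) [set x | product_simplex R N M x /\ x i j = 0].
Proof.
move=> M1.
have [k0 kj] : exists k0 : 'I_M, k0 != j.
  have [->|h] := eqVneq j (Ordinal M1); last by exists (Ordinal M1); rewrite eq_sym.
  by exists (Ordinal (ltn_trans (ltnSn 0) M1)).
apply: (@hnull_simplex_cone _ _ _ _ (delta_mx i j - delta_mx i k0) 1).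
- exact: ltn_trans M1.
- by move=> x [].
- move=> i'; rewrite (eq_bigr (fun k => delta_mx i j i' k - delta_mx i k0 i' k)) => [|k _].
    by rewrite sumrB !sum_delta_mx subrr.
  by rewrite [LHS]mxE; congr (_ + _); rewrite [LHS]mxE.
- apply/eqP => /matrixP/(_ i j); rewrite !mxE !eqxx /= eq_sym (negbTE kj) subr0.
  by apply/eqP; rewrite oner_eq0.
- by [].
- move=> x x' t [_ xij] [_ xij']; rewrite mul1r.
  have := mx_coord_le (x - x' - t *: (delta_mx i j - delta_mx i k0)) i j.
  by rewrite !mxE xij xij' !eqxx /= (eq_sym j) (negbTE kj) !subr0 mulr1 sub0r normrN.
Qed.

(** * Strict differentiability *)

Definition mxdot (R : realType) (m n : nat) (G v : 'M[R]_(m, n)) : R :=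
  \sum_i \sum_j G i j * v i j.

Section Mxdot.
Variables (R : realType) (m n : nat).
Implicit Types (G v : 'M[R]_(m, n)).

Lemma mxdotDl G G' v : mxdot (G + G') v = mxdot G v + mxdot G' v.
Proof.
rewrite /mxdot -big_split; apply: eq_bigr => i _; rewrite -big_split.
by apply: eq_bigr => j _; rewrite mxE mulrDl.
Qed.

Lemma mxdotZl a G v : mxdot (a *: G) v = a * mxdot G v.
Proof.
rewrite /mxdot mulr_sumr; apply: eq_bigr => i _; rewrite mulr_sumr.
by apply: eq_bigr => j _; rewrite mxE mulrA.
Qed.

Lemma mxdotDr G v v' : mxdot G (v + v') = mxdot G v + mxdot G v'.
Proof.
rewrite /mxdot -big_split; apply: eq_bigr => i _; rewrite -big_split.
by apply: eq_bigr => j _; rewrite mxE mulrDr.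
Qed.

Lemma mxdotZr a G v : mxdot G (a *: v) = a * mxdot G v.
Proof.
rewrite /mxdot mulr_sumr; apply: eq_bigr => i _; rewrite mulr_sumr.
by apply: eq_bigr => j _; rewrite mxE mulrCA.
Qed.

Lemma mxdot0l v : mxdot 0 v = 0.
Proof. by rewrite -(scale0r 0) mxdotZl mul0r. Qed.

Lemma mxdot_suml (I : Type) (s : seq I) (F : I -> 'M[R]_(m, n)) v :
  mxdot (\sum_(k <- s) F k) v = \sum_(k <- s) mxdot (F k) v.
Proof.
elim: s => [|k s ih]; first by rewrite !big_nil mxdot0l.
by rewrite !big_cons mxdotDl ih.
Qed.

Lemma mxdot_delta i j v : mxdot (delta_mx i j) v = v i j.
Proof.
rewrite /mxdot (bigD1 i) //= [X in _ + X]big1 => [|k ki].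
  rewrite addr0 (bigD1 j) //= big1 => [|l lj].
    by rewrite mxE !eqxx mul1r addr0.
  by rewrite mxE (negbTE lj) andbF mul0r.
by rewrite big1 // => l _; rewrite mxE (negbTE ki) mul0r.
Qed.

Lemma mxdot_deltar i j G : mxdot G (delta_mx i j) = G i j.
Proof.
rewrite -[RHS](mxdot_delta i j) /mxdot.
by apply: eq_bigr => k _; apply: eq_bigr => l _; rewrite mulrC.
Qed.

(** The l^1 norm of the entries, dual to the sup norm. *)
Definition mxsum G := \sum_i \sum_j `|G i j|.

Lemma mxsum_ge0 G : 0 <= mxsum G.
Proof. by apply: sumr_ge0 => i _; apply: sumr_ge0. Qed.

Lemma mxdot_le G v : `|mxdot G v| <= mxsum G * `|v|.
Proof.
apply: le_trans (ler_norm_sum _ _ _) _; rewrite mulr_suml; apply: ler_sum => i _.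
apply: le_trans (ler_norm_sum _ _ _) _; rewrite mulr_suml; apply: ler_sum => j _.
by rewrite normrM ler_wpM2l // mx_coord_le.
Qed.

End Mxdot.

(** Strict differentiability with gradient G: both points vary. Asking for all small rho lets
    finitely many such conditions be intersected as filter events. *)
Definition sdiff (R : realType) (m n : nat) (f : 'M[R]_(m, n) -> R)
    (y G : 'M[R]_(m, n)) : Prop :=
  forall eta : R, 0 < eta -> \forall rho \near 0^'+, forall x x',
    `|x - y| < rho -> `|x' - y| < rho ->
    `|f x - f x' - mxdot G (x - x')| <= eta * `|x - x'|.

Section Sdiff.
Variables (R : realType) (m n : nat).
Implicit Types (f g : 'M[R]_(m, n) -> R) (x y v G : 'M[R]_(m, n)).

Lemma nbhs_near_radius y (A : set 'M[R]_(m, n)) : nbhs y A ->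
  \forall rho \near 0^'+, forall x, `|x - y| < rho -> A x.
Proof.
move=> /nbhs_ballP[e /= e0 eA]; near=> rho => x xy; apply: eA.
rewrite mx_norm_ball /ball_ /= distrC; apply: lt_trans xy _.
by near: rho; apply: nbhs_right_lt.
Unshelve. all: by end_near. Qed.

Lemma sdiff_lip f y G : sdiff f y G ->
  \forall rho \near 0^'+, forall x x', `|x - y| < rho -> `|x' - y| < rho ->
    `|f x - f x'| <= (mxsum G + 1) * `|x - x'|.
Proof.
move=> /(_ 1 ltr01); apply: filterS => rho h x x' xy x'y.
have := h x x' xy x'y; rewrite mulrDl.
rewrite -{2}[f x - f x'](subrK (mxdot G (x - x'))) => {}h.
rewrite [leRHS]addrC.
by apply: le_trans (ler_normD _ _) _; apply: lerD => //; apply: mxdot_le.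
Qed.

Lemma sdiff_cont f y G : sdiff f y G -> forall eta : R, 0 < eta ->
  \forall rho \near 0^'+, forall x, `|x - y| < rho -> `|f x - f y| <= eta.
Proof.
move=> hf eta eta0.
have K0 : 0 < mxsum G + 1 by apply: ltr_wpDl => //; apply: mxsum_ge0.
have q0 : 0 < eta / (mxsum G + 1) by apply: divr_gt0.
apply: filterS2 (sdiff_lip hf) (nbhs_right_lt q0) => rho h1 h2 x xy.
apply: le_trans (h1 x y xy _) _.
  by rewrite subrr normr0 (le_lt_trans _ xy).
by rewrite mulrC -ler_pdivlMr // ltW // (lt_trans xy).
Qed.

Lemma sdiff_cst (c : R) y : sdiff (fun=> c) y 0.
Proof.
move=> eta eta0; apply: nearW => rho x x' _ _.
by rewrite mxdot0l !subrr normr0 mulr_ge0 // ltW.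
Qed.

Lemma sdiff_coord i j y : sdiff (fun x => x i j) y (delta_mx i j).
Proof.
move=> eta eta0; apply: nearW => rho x x' _ _.
by rewrite mxdot_delta !mxE subrr normr0 mulr_ge0 // ltW.
Qed.

Lemma sdiffD f g y F G : sdiff f y F -> sdiff g y G ->
  sdiff (fun x => f x + g x) y (F + G).
Proof.
move=> hf hg eta eta0; have e2 : 0 < eta / 2 by rewrite divr_gt0.
apply: filterS2 (hf _ e2) (hg _ e2) => rho h1 h2 x x' xy x'y.
have := h1 x x' xy x'y; have := h2 x x' xy x'y; rewrite mxdotDl.
move: `|x - x'| => d; rewrite !ler_norml => /andP[? ?] /andP[? ?].
by apply/andP; split; lra.
Qed.

Lemma sdiff_sum (I : Type) (s : seq I) (f : I -> 'M[R]_(m, n) -> R)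
    (G : I -> 'M[R]_(m, n)) y :
  (forall i, sdiff (f i) y (G i)) ->
  sdiff (fun x => \sum_(i <- s) f i x) y (\sum_(i <- s) G i).
Proof.
move=> h; elim: s => [|i s ih].
  rewrite big_nil; under [X in sdiff X]eq_fun do rewrite big_nil.
  exact: sdiff_cst.
rewrite big_cons; under [X in sdiff X]eq_fun do rewrite big_cons.
exact: sdiffD.
Qed.

Lemma sdiffM f g y F G : sdiff f y F -> sdiff g y G ->
  sdiff (fun x => f x * g x) y (f y *: G + g y *: F).
Proof.
move=> hf hg eta eta0.
(* The error splits into four products, each at most K e |v|, hence 4 K e <= eta. The bound e <= 1
   keeps f x and g x' within 1 of f y and g y. *)
pose K := `|f y| + `|g y| + mxsum F + mxsum G + 3.
have [nF nG] := (mxsum_ge0 F, mxsum_ge0 G).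
have K0 : 0 < K by rewrite ltr_wpDl // !addr_ge0.
pose e := Num.min 1 (eta / (4 * K)).
have e0 : 0 < e by rewrite lt_min ltr01 divr_gt0 // mulr_gt0.
have e1 : e <= 1 by rewrite ge_min lexx.
have eK : 4 * K * e <= eta.
  by rewrite mulrC -ler_pdivlMr ?mulr_gt0 // ge_min lexx orbT.
apply: filterS2 (filterI (hf e e0) (hg e e0))
  (filterI (sdiff_cont hf e0) (sdiff_cont hg e0)).
move=> rho [h1 h2] [c1 c2] x x' xy x'y.
have {}h1 := h1 x x' xy x'y; have {}h2 := h2 x x' xy x'y.
have {}c1 := c1 x xy; have {}c2 := c2 x' x'y.
rewrite mxdotDl !mxdotZl.
set v := x - x' in h1 h2 *.
have dF := mxdot_le F v; have dG := mxdot_le G v.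
have -> : f x * g x - f x' * g x' - (f y * mxdot G v + g y * mxdot F v) =
  f x * (g x - g x' - mxdot G v) + (f x - f y) * mxdot G v
  + (g x' * (f x - f x' - mxdot F v) + (g x' - g y) * mxdot F v) by ring.
have fx : `|f x| <= `|f y| + 1.
  rewrite -[f x](subrK (f y)) addrC; apply: le_trans (ler_normD _ _) _.
  by rewrite lerD2l; apply: le_trans c1 e1.
have gx : `|g x'| <= `|g y| + 1.
  rewrite -[g x'](subrK (g y)) addrC; apply: le_trans (ler_normD _ _) _.
  by rewrite lerD2l; apply: le_trans c2 e1.
have t1 : `|f x * (g x - g x' - mxdot G v)| <= K * (e * `|v|).
  rewrite normrM; apply: ler_pM => //; apply: le_trans fx _.
  by rewrite /K -!addrA lerD2l !addrA; have := normr_ge0 (g y); lra.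
have t2 : `|(f x - f y) * mxdot G v| <= K * (e * `|v|).
  rewrite normrM mulrCA; apply: ler_pM => //; apply: le_trans dG _.
  apply: ler_wpM2r => //.
  by rewrite /K; have := normr_ge0 (f y); have := normr_ge0 (g y); lra.
have t3 : `|g x' * (f x - f x' - mxdot F v)| <= K * (e * `|v|).
  rewrite normrM; apply: ler_pM => //; apply: le_trans gx _.
  by rewrite /K; have := normr_ge0 (f y); lra.
have t4 : `|(g x' - g y) * mxdot F v| <= K * (e * `|v|).
  rewrite normrM mulrCA; apply: ler_pM => //; apply: le_trans dF _.
  apply: ler_wpM2r => //.
  by rewrite /K; have := normr_ge0 (f y); have := normr_ge0 (g y); lra.
apply: (@le_trans _ _ (4 * K * e * `|v|)); last by apply: ler_wpM2r.
have -> : 4 * K * e * `|v| =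
  K * (e * `|v|) + K * (e * `|v|) + (K * (e * `|v|) + K * (e * `|v|)) by ring.
by do 2 (apply: le_trans (ler_normD _ _) _; apply: lerD) => //;
  apply: le_trans (ler_normD _ _) _; apply: lerD.
Qed.

Lemma sdiffV f y F : f y != 0 -> sdiff f y F ->
  sdiff (fun x => (f x)^-1) y (- (f y) ^- 2 *: F).
Proof.
move=> fy0 hf eta eta0.
pose a := `|f y|.
have a0 : 0 < a by rewrite normr_gt0.
have nF := mxsum_ge0 F.
(* Since e <= a / 2, the values of f stay at least a / 2 in modulus, so 1 / (f x f x') is at most 4
   / a^2, and f x f x' differs from (f y)^2 by at most 5/2 a e; the 10 is 5/2 times 4. *)
pose K := 4 / a ^+ 2 + 10 / a ^+ 3 * mxsum F.
have K0 : 0 < K.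
  by rewrite ltr_pwDl ?divr_gt0 ?exprn_gt0 // mulr_ge0 // divr_ge0 // ltW // exprn_gt0.
pose e := Num.min (a / 2) (eta / K).
have e0 : 0 < e by rewrite lt_min !divr_gt0.
have ea : e <= a / 2 by rewrite ge_min lexx.
have eK : K * e <= eta.
  by rewrite mulrC -ler_pdivlMr // ge_min lexx orbT.
apply: filterS2 (hf e e0) (sdiff_cont hf e0) => rho h1 c x x' xy x'y.
have {}h1 := h1 x x' xy x'y; have c1 := c x xy; have c2 := c x' x'y.
set v := x - x' in h1 *; have dF := mxdot_le F v; rewrite mxdotZl.
have lb z : `|f z - f y| <= e -> a / 2 <= `|f z|.
  move=> h; have := lerB_dist (f y) (f z); rewrite distrC -/a => ?; lra.
have p1 := lb _ c1; have p2 := lb _ c2.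
have n1 : f x != 0 by rewrite -normr_gt0; apply: lt_le_trans p1; rewrite divr_gt0.
have n2 : f x' != 0 by rewrite -normr_gt0; apply: lt_le_trans p2; rewrite divr_gt0.
set err := f x - f x' - mxdot F v in h1.
set D := mxdot F v in err h1 dF *.
have -> : (f x)^-1 - (f x')^-1 - - f y ^- 2 * D =
    - (err * (f x * f x')^-1) + D * ((f x * f x' - f y ^+ 2) * (f x * f x')^-1 * f y ^- 2).
  by rewrite /err; field; rewrite n1 n2 fy0.
have u0 : `|(f x * f x')^-1| <= 4 / a ^+ 2.
  rewrite normfV normrM -[leRHS]invrK lef_pV2 ?posrE ?mulr_gt0 ?normr_gt0 ?invr_gt0 ?exprn_gt0 //.
    rewrite invf_div (_ : a ^+ 2 / 4 = (a / 2) * (a / 2)); last by field.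
    by apply: ler_pM => //; rewrite divr_ge0 // ltW.
  by rewrite divr_gt0 // exprn_gt0.
have w : `|f x * f x' - f y ^+ 2| <= 5 / 2 * a * e.
  have -> : f x * f x' - f y ^+ 2 = (f x - f y) * (f x' - f y) + f y * (f x - f y) + f y * (f x' - f y) by ring.
  have b1 : `|(f x - f y) * (f x' - f y)| <= a / 2 * e.
    by rewrite normrM; apply: ler_pM => //; apply: le_trans c1 ea.
  have b2 : `|f y * (f x - f y)| <= a * e by rewrite normrM; apply: ler_pM.
  have b3 : `|f y * (f x' - f y)| <= a * e by rewrite normrM; apply: ler_pM.
  have := ler_normD ((f x - f y) * (f x' - f y) + f y * (f x - f y)) (f y * (f x' - f y)).
  have := ler_normD ((f x - f y) * (f x' - f y)) (f y * (f x - f y)).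
  lra.
have fy2 : `|f y ^- 2| = a ^- 2 by rewrite normfV normrX.
apply: (@le_trans _ _ (e * `|v| * (4 / a ^+ 2) +
    mxsum F * `|v| * (5 / 2 * a * e * (4 / a ^+ 2) * a ^- 2))).
  apply: le_trans (ler_normD _ _) _; apply: lerD.
    by rewrite normrN normrM; apply: ler_pM.
  rewrite normrM; apply: ler_pM => //; rewrite normrM fy2.
  apply: ler_wpM2r; first by rewrite invr_ge0 exprn_ge0 // ltW.
  by rewrite normrM; apply: ler_pM.
have -> : e * `|v| * (4 / a ^+ 2) + mxsum F * `|v| * (5 / 2 * a * e * (4 / a ^+ 2) * a ^- 2)
   = K * e * `|v| by rewrite /K; field; apply: lt0r_neq0.
exact: ler_wpM2r.
Qed.

End Sdiff.

(** * C^1 functions are strictly differentiable; symmetry of the Hessian *)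

Section C1.
Variables (R : realType) (m n : nat).
Implicit Types (f g : 'M[R]_(m, n) -> R) (x y v G : 'M[R]_(m, n)).

Lemma is_derive_line f x v (s : R) : derivable f (x + s *: v) v ->
  is_derive s 1 (fun s => f (x + s *: v)) ('D_v f (x + s *: v)).
Proof.
move=> df.
have E : (fun h : R => h^-1 *: (((fun s => f (x + s *: v)) \o shift s) (h *: (1 : R))
    - f (x + s *: v))) = 
    (fun h : R => h^-1 *: ((f \o shift (x + s *: v)) (h *: v) - f (x + s *: v))).
  apply: funext => h /=; congr (_ *: (f _ - _)).
  by rewrite [h *: 1]mulr1 scalerDl addrCA.
by apply: DeriveDef; rewrite /derivable /derive E.
Qed.

(** Running through the segment with s in [0, 1] treats both signs of t at once. *)
Lemma mvt_line f x v (t : R) :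
  (forall s : R, 0 <= s <= 1 -> derivable f (x + (s * t) *: v) v) ->
  exists2 s : R, 0 <= s <= 1 &
    f (x + t *: v) - f x = t * 'D_v f (x + (s * t) *: v).
Proof.
move=> df; have [->|t0] := eqVneq t 0.
  by exists 0; rewrite ?lexx ?ler01 // scale0r addr0 subrr mul0r.
pose g (s : R) := f (x + s *: (t *: v)).
have sc s : s *: (t *: v) = (s * t) *: v by rewrite scalerA.
have dg (s : R) : 0 <= s <= 1 -> is_derive s 1 g (t * 'D_v f (x + (s * t) *: v)).
  move=> s01.
  have h := is_derive_line (df s s01).
  have -> : g = (fun u => f (x + u *: v)) \o (fun s => s * t).
    by apply: funext => u; rewrite /g /= sc.
  have ds : is_derive s 1 (fun s => s * t) t.
    have -> : (fun s => s * t) = (id : R -> R) * cst t by apply: funext.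
    by apply: is_derive_eq; rewrite /= scaler0 add0r; apply: mulr1.
  by rewrite mulrC; apply: is_derive1_comp.
have cg : {within `[0, 1], continuous g}.
  by apply: derivable_within_continuous => s; rewrite in_itv => /dg[].
have [s sI E] := @MVT R g (fun s => t * 'D_v f (x + (s * t) *: v)) 0 1 ltr01
  (fun s h => dg s (subset_itv_oo_cc h)) cg.
exists s; first exact: subset_itv_oo_cc sI.
by move: E; rewrite /g scale0r addr0 scale1r subr0 mulr1.
Qed.

Lemma derivable_shift f x y v : derivable f (x + y) v ->
  is_derive x v (fun z => f (z + y)) ('D_v f (x + y)).
Proof.
move=> df.
have E : (fun h : R => h^-1 *: (((fun z => f (z + y)) \o shift x) (h *: v) - f (x + y))) =
    (fun h : R => h^-1 *: ((f \o shift (x + y)) (h *: v) - f (x + y))).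
  by apply: funext => h /=; rewrite addrA.
by apply: DeriveDef; rewrite /derivable /derive E.
Qed.

(* Coordinates are changed one at a time, applying the mean value theorem to each. *)
Lemma C1_sdiff f (U : set 'M[R]_(m, n)) y : open U -> U y -> C1_on U f ->
  sdiff f y (\matrix_(i, j) partial i j f y).
Proof.
move=> oU Uy fU eta eta0.
(* Each of the m n coordinate changes contributes an error eta'; the successor avoids a division by
   zero for empty matrices. *)
pose eta' := eta / (m * n).+1%:R.
have eta'0 : 0 < eta' by apply: divr_gt0.
have near_part : \forall rho \near 0^'+, forall x, `|x - y| < rho ->
    U x /\ forall i j, `|partial i j f x - partial i j f y| <= eta'.
  have HU : nbhs y U by exact: open_nbhs_nbhs.
  have Hij i j : nbhs y [set x | `|partial i j f x - partial i j f y| <= eta'].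
    have [_ /cvgrPdist_le/(_ _ eta'0)] := fU y Uy i j.
    by apply: filterS => x /=; rewrite distrC.
  have FF : Filter (nbhs y) by exact: nbhs_filter.
  have Hi i := @filter_forall _ _ _ (nbhs y) FF (Hij i).
  have Hp := @filter_forall _ _ _ (nbhs y) FF Hi.
  exact: nbhs_near_radius (filterI HU Hp).
apply: filterS near_part => rho H x x' xy x'y.
pose mix (s : seq ('I_m * 'I_n)) : 'M[R]_(m, n) :=
  \matrix_(i, j) if (i, j) \in s then x i j else x' i j.
pose S (s : seq ('I_m * 'I_n)) := \sum_(p <- s) partial p.1 p.2 f y * (x - x') p.1 p.2.
have rho0 : 0 < rho by apply: le_lt_trans xy.
have step s : uniq s ->
    `|f (mix s) - f x' - S s| <= (size s)%:R * (eta' * `|x - x'|).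
  elim: s => [_|[a b] s ih /= /andP[ps us]].
    rewrite /S big_nil subr0 mul0r normr_le0 subr_eq0; apply/eqP; congr f.
    by apply/matrixP => i j; rewrite mxE.
  set t := (x - x') a b.
  have mixE : mix ((a, b) :: s) = mix s + t *: delta_mx a b.
    apply/matrixP => i j; rewrite !mxE in_cons -pair_eqE /=.
    have [->|ia] := eqVneq i a; last by rewrite mulr0 addr0.
    have [->|jb] := eqVneq j b; last by rewrite mulr0 addr0.
    by rewrite (negbTE ps) mulr1 /t !mxE addrC subrK.
  (* For the sup norm, a point whose entries lie between those of x and x' is as close to y as the
     farther of the two. *)
  have inball (th : R) : 0 <= th <= 1 ->
      `|mix s + (th * t) *: delta_mx a b - y| < rho.
    move=> /andP[th0 th1].
    apply: (@le_lt_trans _ _ (Num.max `|x - y| `|x' - y|)); last by rewrite gt_max xy.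
    apply: mx_norm_leP => [|i j]; first by rewrite le_max normr_ge0.
    have h1 : `|x i j - y i j| <= Num.max `|x - y| `|x' - y|.
      by rewrite le_max; have := mx_coord_le (x - y) i j; rewrite !mxE => ->.
    have h2 : `|x' i j - y i j| <= Num.max `|x - y| `|x' - y|.
      by rewrite le_max; have := mx_coord_le (x' - y) i j; rewrite !mxE => ->; rewrite orbT.
    move: h1 h2; move: (Num.max _ _) => C; rewrite !mxE.
    have [->|ia] := eqVneq i a; last by rewrite mulr0 addr0; case: ifP.
    have [->|jb] := eqVneq j b; last by rewrite mulr0 addr0; case: ifP.
    rewrite (negbTE ps) mulr1 /t !mxE !ler_norml => /andP[? ?] /andP[? ?].
    by apply/andP; split; nra.
  have [|th th01 E] := @mvt_line f (mix s) (delta_mx a b) t.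
    by move=> th /inball /H [Uz _]; have [] := fU _ Uz a b.
  have [_ /(_ a b) close] := H _ (inball _ th01).
  have -> : f (mix ((a, b) :: s)) - f x' - S ((a, b) :: s) =
     t * (partial a b f (mix s + (th * t) *: delta_mx a b) - partial a b f y) +
     (f (mix s) - f x' - S s).
    rewrite mixE /S big_cons /= -/(S s) -/t mulrBr -[t * partial a b f (_ + _)]E.
    by ring.
  apply: le_trans (ler_normD _ _) _; rewrite -[(size s).+1]add1n natrD mulrDl mul1r.
  apply: lerD (ih us); rewrite normrM mulrC; apply: ler_pM => //.
  exact: mx_coord_le.
have := step (index_enum _) (index_enum_uniq _).
have -> : mix (index_enum _) = x by apply/matrixP => i j; rewrite mxE mem_index_enum.
have -> : S (index_enum _) = mxdot (\matrix_(i, j) partial i j f y) (x - x').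
  rewrite /S /mxdot pair_bigA /=; apply: eq_bigr => -[i j] _ /=.
  by rewrite !mxE.
move=> h; apply: le_trans h _; rewrite mulrA; apply: ler_wpM2r => //.
rewrite /eta' mulrCA; apply: ler_piMr; first exact: ltW.
rewrite ler_pdivrMr // mul1r ler_nat [index_enum _]unlock -enumT -cardE card_prod !card_ord.
exact: leqnSn.
Qed.

(** The mean value theorem along (a, b), applied to F x = f (x + h d') - f x, turns the second
    difference into h times the change of [partial a b f] over the displacement h d', which strict
    differentiability evaluates. *)
Lemma second_difference f (U : set 'M[R]_(m, n)) y a b a' b' GA : open U -> U y ->
  C1_on U f -> sdiff (partial a b f) y GA -> forall eta : R, 0 < eta ->
  \forall h \near 0^'+,
   `|f (y + h *: delta_mx a b + h *: delta_mx a' b') - f (y + h *: delta_mx a b)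
     - (f (y + h *: delta_mx a' b') - f y) - h ^+ 2 * GA a' b'| <= eta * h ^+ 2.
Proof.
move=> oU Uy fU hA eta eta0.
set d := delta_mx a b; set d' := delta_mx a' b'.
have nd i j : `|delta_mx i j : 'M[R]_(m, n)| <= 1.
  by apply: mx_norm_leP => // k l; rewrite mxE; case: (_ && _); rewrite ?normr1 ?normr0.
have near_U : \forall rho \near 0^'+, forall x, `|x - y| < rho -> U x.
  by apply: nbhs_near_radius; apply: open_nbhs_nbhs.
have [rho [rho0 rU rA]] : exists rho : R, [/\ 0 < rho,
    forall x, `|x - y| < rho -> U x
    & forall x x', `|x - y| < rho -> `|x' - y| < rho ->
      `|partial a b f x - partial a b f x' - mxdot GA (x - x')| <= eta * `|x - x'|].
  have [rho [[h1 h2] h3]] := @filter_ex _ (0 : R)^'+ _ _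
    (filterI (filterI near_U (hA eta eta0)) (nbhs_right_gt 0)).
  by exists rho.
(* All points used are within 2 h of y. *)
have rho3 : 0 < rho / 3 by apply: divr_gt0.
apply: filterS2 (nbhs_right_gt (0 : R)) (nbhs_right_lt rho3) => h h0 hr.
pose F x := f (x + h *: d') - f x.
have sh (s : R) : 0 <= s <= 1 -> `|s * h| <= h.
  by move=> /andP[s0 s1]; rewrite normrM (gtr0_norm h0) (ger0_norm s0) ler_piMl // ltW.
have near1 (s : R) : 0 <= s <= 1 -> `|y + (s * h) *: d - y| < rho.
  move=> /andP[s0 s1]; rewrite addrC addKr normrZ.
  have : `|s * h| * `|d| <= h * 1.
    by apply: ler_pM => //; [apply: sh; rewrite s0 s1|apply: nd].
  by lra.
have near2 (s : R) : 0 <= s <= 1 -> `|y + (s * h) *: d + h *: d' - y| < rho.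
  move=> /andP[s0 s1]; rewrite [_ - y]addrAC (addrAC y) subrr add0r.
  have h1 : `|s * h| * `|d| <= h * 1.
    by apply: ler_pM => //; [apply: sh; rewrite s0 s1|apply: nd].
  have h2 : `|h| * `|d'| <= h * 1 by apply: ler_pM; rewrite ?nd // gtr0_norm.
  apply: le_lt_trans (ler_normD _ _) _; apply: (@le_lt_trans _ _ (h * 1 + h * 1)); last lra.
  by apply: lerD; rewrite normrZ.
have dF (s : R) : 0 <= s <= 1 -> is_derive (y + (s * h) *: d) d F
   (partial a b f (y + (s * h) *: d + h *: d') - partial a b f (y + (s * h) *: d)).
  move=> s01; apply: is_deriveB.
    by apply: derivable_shift; have [] := fU _ (rU _ (near2 s s01)) a b.
  by apply: derivableP; have [] := fU _ (rU _ (near1 s s01)) a b.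
have [s s01 E] := @mvt_line F y d h (fun s h => @ex_derive _ _ _ _ _ _ _ (dF s h)).
have -> : f (y + h *: d + h *: d') - f (y + h *: d) - (f (y + h *: d') - f y) =
    F (y + h *: d) - F y by [].
rewrite E (@derive_val _ _ _ _ _ _ _ (dF s s01)).
have := rA _ _ (near2 s s01) (near1 s s01).
rewrite [X in mxdot GA X](_ : _ = h *: d'); last by rewrite addrAC subrr add0r.
rewrite [X in eta * `|X|](_ : _ = h *: d'); last by rewrite addrAC subrr add0r.
rewrite mxdotZr mxdot_deltar normrZ gtr0_norm // => k.
rewrite expr2 -mulrA -mulrBr normrM gtr0_norm // mulrCA ler_pM2l //.
apply: le_trans k _; apply: ler_wpM2l; first exact: ltW.
by rewrite ler_piMr ?nd // ltW.
Qed.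

(** The second difference is symmetric in the two directions, so both mixed partials are within eta
    / 2 of the same quotient by h^2. *)
Lemma clairaut f (U : set 'M[R]_(m, n)) y a b a' b' : open U -> U y -> C2_on U f ->
  partial a b (partial a' b' f) y = partial a' b' (partial a b f) y.
Proof.
move=> oU Uy [fU f2U].
have [GA hA <-] : exists2 GA, sdiff (partial a b f) y GA &
    GA a' b' = partial a' b' (partial a b f) y.
  by eexists; [exact: C1_sdiff oU Uy (f2U a b)|rewrite mxE].
have [GB hB <-] : exists2 GB, sdiff (partial a' b' f) y GB &
    GB a b = partial a b (partial a' b' f) y.
  by eexists; [exact: C1_sdiff oU Uy (f2U a' b')|rewrite mxE].
apply/eqP; rewrite -subr_eq0 -normr_le0; apply/ler_addgt0Pr => eta eta0; rewrite add0r.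
have e2 : 0 < eta / 2 by apply: divr_gt0.
have [h [[h1 h2] h0]] := @filter_ex _ (0 : R)^'+ _ _ (filterI (filterI
  (second_difference a' b' oU Uy fU hA e2)
  (second_difference a b oU Uy fU hB e2)) (nbhs_right_gt 0)).
rewrite (addrAC y) in h2.
have hh : 0 < h ^+ 2 by apply: exprn_gt0.
rewrite -(ler_pM2l hh) -{1}(gtr0_norm hh) -normrM.
move: h1 h2; move: (GA _ _) (GB _ _) => A B.
move: (f _) (f _) (f _) (f y) => p q r s.
rewrite !ler_norml => /andP[? ?] /andP[? ?].
by apply/andP; split; lra.
Qed.

End C1.

(** * Quadratic forms expanded by a linear map *)

Section Forms.
Variables (R : realType) (m n : nat).
Local Notation V := 'M[R]_(m, n).
Implicit Types (u v w : V).

Definition lin (f : V -> V) := forall a u v, f (a *: u + v) = a *: f u + f v.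

Definition bil (b : V -> V -> R) :=
  (forall a u u' v, b (a *: u + u') v = a * b u v + b u' v) /\
  (forall a u v v', b u (a *: v + v') = a * b u v + b u v').

Lemma lin0 f : lin f -> f 0 = 0.
Proof.
move=> h; have := h (-1) 0 0; rewrite scaleN1r oppr0 addr0 scaleN1r.
by rewrite addNr.
Qed.

Lemma linD f u v : lin f -> f (u + v) = f u + f v.
Proof. by move=> h; have := h 1 u v; rewrite !scale1r. Qed.

Lemma linZ f a u : lin f -> f (a *: u) = a *: f u.
Proof. by move=> h; have := h a u 0; rewrite !addr0 lin0 // addr0. Qed.

Lemma linB f u v : lin f -> f (u - v) = f u - f v.
Proof. by move=> h; rewrite -scaleN1r linD // linZ // scaleN1r. Qed.

Lemma lin_comp f g : lin f -> lin g -> lin (f \o g).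
Proof. by move=> hf hg a u v /=; rewrite hg hf. Qed.

Lemma bilDl b u u' v : bil b -> b (u + u') v = b u v + b u' v.
Proof. by move=> [h _]; have := h 1 u u' v; rewrite scale1r mul1r. Qed.

Lemma bilDr b u v v' : bil b -> b u (v + v') = b u v + b u v'.
Proof. by move=> [_ h]; have := h 1 u v v'; rewrite scale1r mul1r. Qed.

Lemma bil0l b v : bil b -> b 0 v = 0.
Proof. by move=> h; have := bilDl 0 0 v h; rewrite addr0; lra. Qed.

Lemma bil0r b u : bil b -> b u 0 = 0.
Proof. by move=> h; have := bilDr u 0 0 h; rewrite addr0; lra. Qed.

Lemma bilZl b a u v : bil b -> b (a *: u) v = a * b u v.
Proof. by move=> h; have [/(_ a u 0 v) + _] := h; rewrite addr0 bil0l ?addr0. Qed.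

Lemma bilZr b a u v : bil b -> b u (a *: v) = a * b u v.
Proof. by move=> h; have [_ /(_ a u v 0)] := h; rewrite addr0 bil0r ?addr0. Qed.

Lemma bil_comp b f g : bil b -> lin f -> lin g -> bil (fun u v => b (f u) (g v)).
Proof. by move=> [h1 h2] hf hg; split=> a u v w; rewrite ?hf ?hg ?h1 ?h2. Qed.

Lemma bil_comb b b' (k : R) : bil b -> bil b' -> bil (fun u v => b u v + k * b' u v).
Proof. by move=> [h1 h2] [h3 h4]; split=> a u v w; rewrite ?h1 ?h2 ?h3 ?h4; ring. Qed.

Lemma scalar_mxdot (f : V -> R) : (forall a u v, f (a *: u + v) = a * f u + f v) ->
  forall v, f v = mxdot (\matrix_(i, j) f (delta_mx i j)) v.
Proof.
move=> h.
have f0 : f 0 = 0 by have := h 1 0 0; rewrite scale1r addr0 mul1r; lra.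
have fsum (I : Type) (s : seq I) (a : I -> R) (F : I -> V) :
    f (\sum_(i <- s) a i *: F i) = \sum_(i <- s) a i * f (F i).
  by elim: s => [|i s ih]; rewrite ?big_nil // !big_cons h ih.
move=> v; rewrite {1}[v]matrix_sum_delta /mxdot pair_bigA fsum [RHS]pair_bigA.
by apply: eq_bigr => -[i j] _ /=; rewrite mxE mulrC.
Qed.

Lemma bil_bounded b : bil b -> exists2 C : R, 0 <= C &
  forall u v, `|b u v| <= C * `|u| * `|v|.
Proof.
move=> [h1 h2].
pose C := \sum_i \sum_j mxsum (\matrix_(k, l) b (delta_mx k l) (delta_mx i j)).
exists C => [|u v]; first by apply: sumr_ge0 => i _; apply: sumr_ge0 => j _; apply: mxsum_ge0.
have -> := @scalar_mxdot (b u) (fun a => h2 a u) v.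
apply: le_trans (mxdot_le _ _) _; apply: ler_wpM2r => //.
rewrite mulr_suml; apply: ler_sum => i _; rewrite mulr_suml; apply: ler_sum => j _.
rewrite mxE.
have -> := @scalar_mxdot (b^~ (delta_mx i j)) (fun a u v => h1 a u v (delta_mx i j)) u.
exact: mxdot_le.
Qed.

Lemma lin_bounded f : lin f -> exists2 C : R, 0 <= C & forall v, `|f v| <= C * `|v|.
Proof.
move=> h; pose C := \sum_i \sum_j mxsum (\matrix_(k, l) f (delta_mx k l) i j).
have C0 : 0 <= C by apply: sumr_ge0 => i _; apply: sumr_ge0 => j _; apply: mxsum_ge0.
exists C => // v; apply: mx_norm_leP => [|i j]; first exact: mulr_ge0.
have -> := @scalar_mxdot (fun v => f v i j) _ v; last by move=> a w z; rewrite h !mxE.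
apply: le_trans (mxdot_le _ _) _; apply: ler_wpM2r => //.
rewrite /C (bigD1 i) //= (bigD1 j) //= -addrA lerDl addr_ge0 //.
  by apply: sumr_ge0 => k _; apply: mxsum_ge0.
by apply: sumr_ge0 => k _; apply: sumr_ge0 => l _; apply: mxsum_ge0.
Qed.

(** The nonzero polynomial p has fewer than [size p] roots, so one of the [size p] distinct numbers
    d0 / (i + 2), all below d0, is not a root. *)
Lemma exists_non_eigenvalue (k : nat) (L : 'M[R]_k) (d0 : R) : 0 < d0 ->
  exists2 d : R, 0 < d < d0 & L - d%:M \in unitmx.
Proof.
move=> d00.
pose p := char_poly L; pose rs := [seq d0 / i.+2%:R | i <- iota 0 (size p)].
have [/allP H|] := boolP (all (root p) rs); last first.
  rewrite -has_predC => /hasP[d /mapP[i _ ->] /= nr].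
  exists (d0 / i.+2%:R).
    by rewrite divr_gt0 //= ltr_pdivrMr // ltr_pMr // ltr1n.
  move: nr; rewrite -eigenvalue_root_char /eigenvalue negbK kermx_eq0.
  by rewrite row_free_unit.
have p0 : p != 0 by apply/monic_neq0/char_poly_monic.
have urs : uniq rs.
  rewrite map_inj_in_uniq ?iota_uniq // => i j _ _ /(mulfI (lt0r_neq0 d00))/invr_inj.
  by move=> /eqP; rewrite eqr_nat => /eqP[].
have := max_poly_roots p0 (introT allP H) urs.
by rewrite size_map size_iota ltnn.
Qed.

(** For d outside the spectrum, f - d has an inverse G, bounded because the dimension is finite. *)
Lemma lin_shift_bounded_below (f : V -> V) (d0 : R) : lin f -> 0 < d0 ->
  exists2 d : R, 0 < d < d0 &
    exists2 g : R, 0 < g & forall u, `|u| <= g * `|f u - d *: u|.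
Proof.
move=> hf d00.
pose F : {linear V -> V} := HB.pack f (GRing.isLinear.Build R V V *:%R f hf).
have [d dI dU] := exists_non_eigenvalue (lin_mx F) d00.
exists d => //.
pose G w := vec_mx (mxvec w *m invmx (lin_mx F - d%:M)) : V.
have hG : lin G by move=> a u v; rewrite /G linearP mulmxDl -scalemxAl linearP.
have [C C0 hC] := lin_bounded hG.
exists (C + 1) => [|u]; first by rewrite ltr_wpDl.
have GK : G (f u - d *: u) = u.
  rewrite /G linearB linearZ /= -[f u]/(F u) -mul_vec_lin -mul_mx_scalar -mulmxBr.
  by rewrite mulmxK // mxvecK.
by rewrite -{1}GK; apply: le_trans (hC _) _; rewrite ler_wpM2r // lerDl.
Qed.

(* The form is [ip u ((S - delta) u)] on F, where 1 + delta is not an eigenvalue of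
   J, minus a large multiple of [nq] in the complementary direction. *)
Lemma expanded_form (ip nq : V -> V -> R) (S Pi J : V -> V) (F Tg : V -> Prop)
    (e : V) (c0 K0 : R) :
  bil ip -> bil nq -> lin S -> lin Pi -> lin J ->
  (forall u v, ip u v = ip v u) -> 0 < c0 -> (forall u, c0 * `|u| ^+ 2 <= ip u u) ->
  (forall v, 0 <= nq v v) -> 0 <= K0 ->
  (forall a u v, F u -> F v -> F (a *: u + v)) ->
  (forall v, F (Pi v)) -> (forall u, F u -> Pi u = u) ->
  (forall u, F u -> F (S u)) -> (forall u v, F u -> F v -> ip (S u) v = ip u (S v)) ->
  (forall u, F u -> 0 <= ip u u + ip u (S u)) ->
  (forall u, F u -> J u = u + S u) ->
  (forall v, Tg v -> nq (J v) (J v) <= nq v v) ->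
  (forall v, Tg v -> `|v - Pi v| ^+ 2 <= K0 * nq v v) ->
  F e -> 0 < ip e (S e) -> nq e e = 0 ->
  exists b lambda c, [/\ bil b, 1 < lambda, 0 < c, 0 < b e e &
    forall v, Tg v -> lambda * b v v + c * `|v| ^+ 2 <= b (J v) (J v)].
Proof.
move=> bip bnq lS lPi lJ ipC c00 ipdef nq0 K00 FD FPi PiF FS Ssym Spos JF nqJ nqPi Fe eSe nqe.
have ipe : 0 < ip e e.
  rewrite (lt_le_trans _ (ipdef e)) // mulr_gt0 // exprn_gt0 // normr_gt0.
  by apply/eqP => e0; move: eSe; rewrite e0 bil0l ?ltxx.
(* Lying below the Rayleigh quotient of e, d leaves the form positive at e; avoiding the eigenvalues
   of S gives |u| <= g |A u|. *)
have [d /andP[d0 d1] [g g0 hg]] := lin_shift_bounded_below lS (divr_gt0 eSe ipe).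
pose A u := S u - d *: u.
have lA : lin A by move=> a u v; rewrite /A lS scalerDr !scalerA mulrC opprD addrACA scalerBr scalerA.
pose B u v := ip u (A v).
have bB : bil B by apply: (bil_comp bip (f := id)) lA.
have FA u : F u -> F (A u).
  by move=> Fu; rewrite /A addrC -scaleNr; apply: FD => //; apply: FS.
have Asym u v : F u -> F v -> ip (A u) v = ip u (A v).
  move=> Fu Fv; rewrite /A -!scaleNr bilDl // bilDr // bilZl // bilZr // Ssym //.
have AE u : S u = A u + d *: u by rewrite subrK.
pose c1 := c0 / g ^+ 2.
have c10 : 0 < c1 by rewrite divr_gt0 // exprn_gt0.
have BJ u : F u -> (1 + d) ^+ 2 * B u u + c1 * `|u| ^+ 2 <= B (J u) (J u).
  move=> Fu; have [w Fw wE] : exists2 w, F w & A u = w by exists (A u) => //; apply: FA.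
  have -> : J u = (1 + d) *: u + w by rewrite JF // AE wE scalerDl scale1r [w + _]addrC addrA.
  rewrite (bilDl _ _ _ bB) (bilZl _ _ _ bB) !(bilDr _ _ _ bB) !(bilZr _ _ _ bB).
  (* By self-adjointness both cross terms equal ip w w. Positivity of 1 + S at w controls B w w, and
     what remains is at least ip w w >= c1 |u|^2. *)
  have -> : B u w = ip w w by rewrite /B -Asym // wE.
  have -> : B w u = ip w w by rewrite /B wE.
  have h1 := Spos _ Fw; rewrite AE (bilDr _ _ _ bip) (bilZr _ _ _ bip) in h1.
  have h2 : c1 * `|u| ^+ 2 <= ip w w.
    apply: le_trans (ipdef w); rewrite -wE /c1 -mulrA ler_pM2l // mulrC ler_pdivrMr ?exprn_gt0 //.
    by rewrite mulrC -exprMn lerXn2r ?nnegrE ?mulr_ge0 ?(ltW g0) //; apply: hg.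
  have h3 : 0 <= ip w w by apply: le_trans (ipdef w); rewrite mulr_ge0 ?exprn_ge0 // ltW.
  rewrite -/(B w w) in h1; set p := ip w w in h1 h2 h3 *; set q := B w w in h1 *.
  set r := B u u; set s := c1 * _ in h2 *.
  have -> : (1 + d) * ((1 + d) * r + p) + ((1 + d) * p + q) =
    (1 + d) ^+ 2 * r + (p + (p + d * p + q) + d * p) by ring.
  have : 0 <= d * p by rewrite mulr_ge0 // ltW.
  by lra.
have [CB CB0 hB] := bil_bounded bB.
have [CJ CJ0 hJ] := lin_bounded lJ.
have [C2 C20 hC2] := lin_bounded (lin_comp lPi lJ).
(* Weight of |z|^2 after half of the margin c1 |u|^2 has been spent on the cross terms between J u
   and z; C4 converts |z|^2 into nq v v. *)
pose C3 := CB + 2 * (CB * CJ) ^+ 2 / c1.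
have C30 : 0 <= C3 by apply: addr_ge0 => //; apply: divr_ge0; [apply: mulr_ge0 => //; apply: sqr_ge0|apply: ltW].
pose C4 := C3 * (C2 ^+ 2 * K0).
have C40 : 0 <= C4 by apply: mulr_ge0 => //; apply: mulr_ge0 => //; apply: sqr_ge0.
(* Since (1 + d)^2 - 1 >= 2 d, the term - K nq gains at least (C4 + 1) nq v v: C4 pays for z, the 1
   for the part of |v|^2 outside F. *)
pose K := (C4 + 1) / (2 * d).
have K_ge0 : 0 <= K by apply: divr_ge0; [apply: addr_ge0|apply: mulr_ge0 => //; apply: ltW].
pose b u v := B (Pi u) (Pi v) + (- K) * nq u v.
(* From |v|^2 <= 2 |v - u|^2 + 2 |u|^2, this makes c |v|^2 at most c1 / 2 |u|^2 + nq v v, which is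
   exactly the margin left. *)
pose c := Num.min (c1 / 4) (1 / (2 * K0 + 1)).
have K01 : 0 < 2 * K0 + 1 by rewrite ltr_wpDl // mulr_ge0.
have c_gt0 : 0 < c by rewrite lt_min; apply/andP; split; apply: divr_gt0.
exists b, ((1 + d) ^+ 2), c; split=> //.
- by apply: bil_comb => //; apply: (bil_comp bB).
- by rewrite exprn_egt1 // ltrDl.
- rewrite /b PiF // nqe mulr0 addr0 /B /A bilDr // -scaleNr bilZr // mulNr subr_gt0.
  by rewrite -ltr_pdivlMr.
move=> v Tv; set u := Pi v.
have Fu : F u by apply: FPi.
(* J preserves F but not the complement: z is what leaks into F from the component of v outside
   it. *)
pose z := Pi (J (v - u)).
have PJv : Pi (J v) = J u + z.
  have FJu : F (J u) by rewrite JF // -[u in u + _]scale1r; apply: FD => //; apply: FS.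
  by rewrite /z linB // linB // (PiF _ FJu) addrC subrK.
set N := nq v v.
have N0 : 0 <= N by apply: nq0.
have dN : `|v - u| ^+ 2 <= K0 * N by apply: nqPi.
have zN : `|z| ^+ 2 <= C2 ^+ 2 * K0 * N.
  apply: (@le_trans _ _ ((C2 * `|v - u|) ^+ 2)).
    by rewrite lerXn2r ?nnegrE ?mulr_ge0 //; apply: hC2.
  by rewrite exprMn -mulrA ler_wpM2l ?exprn_ge0.
have vN : c * `|v| ^+ 2 <= c1 / 2 * `|u| ^+ 2 + N.
  have h : `|v| <= `|v - u| + `|u| by rewrite -{1}[v](subrK u); apply: ler_normD.
  have h' : `|v| ^+ 2 <= 2 * `|v - u| ^+ 2 + 2 * `|u| ^+ 2.
    apply: (@le_trans _ _ ((`|v - u| + `|u|) ^+ 2)).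
      by rewrite lerXn2r ?nnegrE ?addr_ge0.
    by move: `|v - u| `|u| => x y; have := sqr_ge0 (x - y); rewrite !expr2; lra.
  have ca : c * (2 * `|u| ^+ 2) <= c1 / 4 * (2 * `|u| ^+ 2).
    by apply: ler_wpM2r; rewrite ?mulr_ge0 ?exprn_ge0 // ge_min lexx.
  have cb : c * (2 * `|v - u| ^+ 2) <= 1 / (2 * K0 + 1) * (2 * (K0 * N)).
    apply: ler_pM => //; rewrite ?mulr_ge0 ?exprn_ge0 ?(ltW c_gt0) //.
      by rewrite ge_min lexx orbT.
    by rewrite ler_pM2l.
  have cc : 1 / (2 * K0 + 1) * (2 * (K0 * N)) <= N.
    by rewrite mul1r mulrC ler_pdivrMr //; lra.
  apply: (@le_trans _ _ (c * (2 * `|v - u| ^+ 2 + 2 * `|u| ^+ 2))).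
    by rewrite ler_pM2l.
  by rewrite mulrDr; lra.
have Bz : B (J u) (J u) - c1 / 2 * `|u| ^+ 2 - C3 * `|z| ^+ 2 <= B (J u + z) (J u + z).
  rewrite (bilDl _ _ _ bB) !(bilDr _ _ _ bB).
  have h1 : `|B (J u) z| <= CB * CJ * `|u| * `|z|.
    apply: le_trans (hB _ _) _; apply: ler_wpM2r => //.
    by rewrite -mulrA; apply: ler_wpM2l => //; apply: hJ.
  have h2 : `|B z (J u)| <= CB * CJ * `|u| * `|z|.
    apply: le_trans (hB _ _) _.
    have -> : CB * CJ * `|u| * `|z| = CB * `|z| * (CJ * `|u|) by ring.
    by apply: ler_wpM2l; [apply: mulr_ge0|apply: hJ].
  have h3 : `|B z z| <= CB * `|z| * `|z| by apply: hB.
  (* AM-GM *)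
  have h4 : 2 * (CB * CJ * `|u| * `|z|) <= c1 / 2 * `|u| ^+ 2 + 2 * (CB * CJ) ^+ 2 / c1 * `|z| ^+ 2.
    rewrite -subr_ge0; have -> : c1 / 2 * `|u| ^+ 2 + 2 * (CB * CJ) ^+ 2 / c1 * `|z| ^+ 2
      - 2 * (CB * CJ * `|u| * `|z|) = (c1 * `|u| - 2 * (CB * CJ) * `|z|) ^+ 2 / (2 * c1).
      by field; apply: lt0r_neq0.
    by rewrite divr_ge0 ?sqr_ge0 // mulr_ge0 // ltW.
  move: h1 h2 h3; rewrite !ler_norml => /andP[h1 _] /andP[h2 _] /andP[h3 _].
  rewrite /C3 mulrDl; rewrite -[CB * `|z| * `|z|]mulrA -expr2 in h3.
  by lra.
rewrite /b PJv -/u -/N.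
have h1 := BJ u Fu.
have h2 : C3 * `|z| ^+ 2 <= C4 * N.
  by rewrite /C4 -mulrA; apply: ler_wpM2l.
have h3 : K * nq (J v) (J v) <= K * N by apply: ler_wpM2l => //; apply: nqJ.
have h4 : K * N + N + C4 * N <= (1 + d) ^+ 2 * (K * N).
  have E : 2 * d * K = C4 + 1 by rewrite /K mulrC divfK // mulf_neq0 // lt0r_neq0.
  have : 0 <= d ^+ 2 * (K * N) by apply: mulr_ge0; [apply: sqr_ge0|apply: mulr_ge0].
  have -> : (1 + d) ^+ 2 * (K * N) = K * N + (2 * d * K) * N + d ^+ 2 * (K * N) by ring.
  by rewrite E; lra.
rewrite mulrDr !mulNr mulrN; lra.
Qed.

End Forms.

(** * Points whose orbit stays near a fixed point *)

Lemma geometric_unbounded (R : realType) (lambda a C : R) : 1 < lambda -> 0 < a ->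
  (forall k, lambda ^+ k * a <= C) -> False.
Proof.
move=> l1 a0 H.
have bern k : 1 + k%:R * (lambda - 1) <= lambda ^+ k.
  elim: k => [|k ih]; first by rewrite mul0r addr0 expr0.
  rewrite exprS -natr1; have k0 : 0 <= k%:R * (lambda - 1) ^+ 2 :> R.
    by rewrite mulr_ge0 // sqr_ge0.
  apply: (@le_trans _ _ (lambda * (1 + k%:R * (lambda - 1)))).
    by rewrite expr2 in k0; lra.
  by rewrite ler_pM2l // (lt_trans ltr01).
have l0 : 0 < lambda - 1 by rewrite subr_gt0.
pose x := `|C| / (a * (lambda - 1)).
have x0 : 0 <= x by rewrite divr_ge0 // mulr_ge0 // ltW.
have := archi_boundP x0; set k := Num.bound x => xk.
have := H k; apply/negP; rewrite -ltNge.
apply: (@lt_le_trans _ _ ((1 + k%:R * (lambda - 1)) * a)); last first.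
  by rewrite ler_pM2r.
move: xk; rewrite /x ltr_pdivrMr ?mulr_gt0 // => xk.
by have := ler_norm C; lra.
Qed.

Definition stays_near (R : realType) (N M : nat) (T : 'M[R]_(N, M) -> 'M[R]_(N, M))
    (B : set 'M[R]_(N, M)) : set 'M[R]_(N, M) :=
  [set x | product_simplex R N M x /\ forall k, B (iter k T x)].

Definition jacobian_map (R : realType) (N M : nat) (G : 'I_N -> 'I_M -> 'M[R]_(N, M))
  (v : 'M[R]_(N, M)) : 'M[R]_(N, M) := \matrix_(i, j) mxdot (G i j) v.

Lemma jacobian_map_lin (R : realType) (N M : nat) (G : 'I_N -> 'I_M -> 'M[R]_(N, M)) :
  lin (jacobian_map G).
Proof. by move=> a u v; apply/matrixP => i j; rewrite !mxE mxdotDr mxdotZr. Qed.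

Lemma sdiff_jacobian (R : realType) (N M : nat) (T : 'M[R]_(N, M) -> 'M[R]_(N, M)) y
    (G : 'I_N -> 'I_M -> 'M[R]_(N, M)) (eta : R) :
  (forall i j, sdiff (fun x => T x i j) y (G i j)) -> 0 < eta ->
  exists2 rho : R, 0 < rho & forall x x', `|x - y| < rho -> `|x' - y| < rho ->
    `|T x - T x' - jacobian_map G (x - x')| <= eta * `|x - x'|.
Proof.
move=> hT eta0.
have FF : Filter ((0 : R)^'+) by apply: at_right_proper_filter.
have Hij i j := hT i j eta eta0.
have Hi i := @filter_forall _ _ _ ((0 : R)^'+) FF (Hij i).
have H := @filter_forall _ _ _ ((0 : R)^'+) FF Hi.
have [rho [h1 h2]] := @filter_ex _ (0 : R)^'+ _ _ (filterI H (nbhs_right_gt 0)).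
exists rho => // x x' xy x'y; apply: mx_norm_leP => [|i j].
  by rewrite mulr_ge0 // ltW.
by rewrite !mxE; apply: h1.
Qed.

(** The margin c |v|^2 absorbs the error T x - T x' - J (x - x'), so the expansion passes from J to
    differences of T. As b is positive in a cone around e, the resulting sign condition on
    differences is the one of [hnull_simplex_cone]. *)
Lemma expanding_form_null (R : realType) (N M : nat) (T : 'M[R]_(N, M) -> 'M[R]_(N, M))
    (y e : 'M[R]_(N, M)) (G : 'I_N -> 'I_M -> 'M[R]_(N, M))
    (b : 'M[R]_(N, M) -> 'M[R]_(N, M) -> R) (lambda c : R) : (0 < M)%N ->
  (forall x, product_simplex R N M x -> product_simplex R N M (T x)) ->
  (forall i j, sdiff (fun x => T x i j) y (G i j)) ->
  bil b -> 1 < lambda -> 0 < c -> tangent e -> 0 < b e e ->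
  (forall v, tangent v ->
    lambda * b v v + c * `|v| ^+ 2 <= b (jacobian_map G v) (jacobian_map G v)) ->
  exists2 rho : R, 0 < rho &
    hnull (N * M.-1) (stays_near T [set x | `|x - y| < rho]).
Proof.
move=> M0 TD hT bb l1 c0 te be expand.
set J := jacobian_map G in expand *.
have [CJ CJ0 hJ] := lin_bounded (jacobian_map_lin G); rewrite -/J in hJ.
have [Cb Cb0 hb] := bil_bounded bb.
(* With |z| <= eta |v| and eta <= 1, the three terms of b (J v + z) (J v + z) containing z sum to at
   most Q eta |v|^2. *)
pose Q := Cb * (2 * CJ + 1).
have Q0 : 0 <= Q by rewrite mulr_ge0 // addr_ge0 // mulr_ge0.
pose eta := Num.min 1 (c / (Q + 1)).
have Q1 : 0 < Q + 1 by rewrite ltr_wpDl.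
have eta0 : 0 < eta by rewrite lt_min ltr01 divr_gt0.
have eta1 : eta <= 1 by rewrite ge_min lexx.
have etaQ : Q * eta <= c.
  apply: (@le_trans _ _ ((Q + 1) * eta)).
    by apply: ler_wpM2r; [apply: ltW|rewrite lerDl].
  by rewrite mulrC -ler_pdivlMr // ge_min lexx orbT.
have [rho rho0 hrho] := sdiff_jacobian hT eta0; rewrite -/J in hrho.
exists rho => //; set W := stays_near _ _.
have step x x' : product_simplex R N M x -> product_simplex R N M x' ->
    `|x - y| < rho -> `|x' - y| < rho ->
    lambda * b (x - x') (x - x') <= b (T x - T x') (T x - T x').
  move=> Dx Dx' xy x'y; have := hrho x x' xy x'y.
  have := expand _ (tangentB Dx Dx'); move: (x - x') => v.
  have [z zE] : exists z, z = T x - T x' - J v by eexists.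
  have -> : T x - T x' = J v + z by rewrite zE [RHS]addrC subrK.
  rewrite (addrC (J v)) addrK => hv zv.
  rewrite !(bilDl _ _ _ bb) !(bilDr _ _ _ bb).
  have zv1 : `|z| <= `|v| by apply: le_trans zv _; apply: ler_piMl.
  have h1 : `|b (J v) z| <= Cb * CJ * eta * `|v| ^+ 2.
    apply: le_trans (hb _ _) _.
    have -> : Cb * CJ * eta * `|v| ^+ 2 = Cb * (CJ * `|v|) * (eta * `|v|) by ring.
    apply: ler_pM => //; first exact: mulr_ge0.
    by apply: ler_wpM2l.
  have h2 : `|b z (J v)| <= Cb * CJ * eta * `|v| ^+ 2.
    apply: le_trans (hb _ _) _.
    have -> : Cb * CJ * eta * `|v| ^+ 2 = Cb * (eta * `|v|) * (CJ * `|v|) by ring.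
    apply: ler_pM => //; first exact: mulr_ge0.
    by apply: ler_wpM2l.
  have h3 : `|b z z| <= Cb * eta * `|v| ^+ 2.
    apply: le_trans (hb _ _) _.
    have -> : Cb * eta * `|v| ^+ 2 = Cb * (eta * `|v|) * `|v| by ring.
    apply: ler_pM => //; first exact: mulr_ge0.
    by apply: ler_wpM2l.
  have h4 : Q * eta * `|v| ^+ 2 <= c * `|v| ^+ 2 by apply: ler_wpM2r; rewrite ?sqr_ge0.
  move: h1 h2 h3; rewrite !ler_norml => /andP[h1 _] /andP[h2 _] /andP[h3 _].
  have E : Cb * CJ * eta * `|v| ^+ 2 + Cb * CJ * eta * `|v| ^+ 2 + Cb * eta * `|v| ^+ 2 =
    Q * eta * `|v| ^+ 2 by rewrite /Q; ring.
  lra.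
have iterD k x : product_simplex R N M x -> product_simplex R N M (iter k T x).
  by move=> Dx; elim: k => //= k ih; apply: TD.
have cone x x' : W x -> W x' -> b (x - x') (x - x') <= 0.
  move=> [Dx xW] [Dx' xW']; rewrite leNgt; apply/negP => q0.
  have grow k : lambda ^+ k * b (x - x') (x - x') <=
      b (iter k T x - iter k T x') (iter k T x - iter k T x').
    elim: k => [|k ih]; first by rewrite expr0 mul1r.
    rewrite exprS -mulrA; apply: le_trans (step _ _ _ _ (xW k) (xW' k)); last 2 first.
    - exact: iterD.
    - exact: iterD.
    by rewrite ler_pM2l // (lt_trans ltr01).
  apply: (geometric_unbounded (C := Cb * 2 * 2) l1 q0) => k; apply: le_trans (grow k) _.
  have n2 : `|iter k T x - iter k T x'| <= 2.
    apply: le_trans (ler_normB _ _) _; rewrite -[2]/(1 + 1).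
    by apply: lerD; apply/simplex_norm_le1/iterD.
  apply: le_trans (ler_norm _) _; apply: le_trans (hb _ _) _.
  by apply: ler_pM => //; [apply: mulr_ge0|apply: ler_wpM2l].
(* If |t| > C |z|, then |z| <= |t| and t^2 b e e outweighs all other terms of b (t e + z) (t e + z),
   contradicting the sign. *)
pose C := 1 + (2 * Cb * `|e| + Cb) / b e e.
have CC : 0 <= (2 * Cb * `|e| + Cb) / b e e.
  by apply: divr_ge0; [apply: addr_ge0 => //; apply: mulr_ge0 => //; apply: mulr_ge0|apply: ltW].
have C1 : 1 <= C by rewrite lerDl.
apply: (@hnull_simplex_cone _ _ _ W e C) => //.
- by move=> x [].
- by apply/eqP => e0; move: be; rewrite e0 (bil0l _ bb) ltxx.
- exact: le_trans ler01 C1.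
move=> x x' t Wx Wx'; rewrite leNgt; apply/negP => tC.
have := cone _ _ Wx Wx'; apply/negP; rewrite -ltNge.
have -> : x - x' = t *: e + (x - x' - t *: e) by rewrite [RHS]addrC subrK.
move: (x - x' - t *: e) tC => z tC.
rewrite !(bilDl _ _ _ bb) !(bilDr _ _ _ bb) !(bilZl _ _ _ bb) !(bilZr _ _ _ bb).
have t0 : 0 < `|t| by apply: le_lt_trans tC; rewrite mulr_ge0 // (le_trans ler01).
have h1 : `|b e z| <= Cb * `|e| * `|z| by apply: hb.
have h2 : `|b z e| <= Cb * `|e| * `|z|.
  by apply: le_trans (hb _ _) _; rewrite mulrAC.
have h3 : `|b z z| <= Cb * `|z| * `|z| by apply: hb.
have zt : `|z| <= `|t|.
  by apply: ltW; apply: le_lt_trans tC; rewrite ler_peMl.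
have h4 : `|t * b e z| <= `|t| * (Cb * `|e| * `|z|) by rewrite normrM ler_wpM2l.
have h5 : `|t * b z e| <= `|t| * (Cb * `|e| * `|z|) by rewrite normrM ler_wpM2l.
have h6 : Cb * `|z| * `|z| <= `|t| * (Cb * `|z|).
  by rewrite mulrC [`|t| * _]mulrC mulrC; apply: ler_wpM2l => //; apply: mulr_ge0.
have h7 : `|t| * ((2 * Cb * `|e| + Cb) * `|z|) < `|t| ^+ 2 * b e e.
  have -> : `|t| ^+ 2 * b e e = `|t| * (`|t| * b e e) by rewrite expr2 mulrA.
  rewrite ltr_pM2l // -ltr_pdivrMr //.
  apply: le_lt_trans tC; rewrite mulrAC; apply: ler_wpM2r => //.
  by rewrite /C lerDr.
rewrite real_normK ?num_real // expr2 in h7.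
move: h3 h4 h5; rewrite !ler_norml => /andP[h3 _] /andP[h4 _] /andP[h5 _].
by lra.
Qed.


(** * From local to global null sets *)

Lemma rational_balls (R : realType) (m n : nat) (x : 'M[R]_(m, n)) (rho : R) : 0 < rho ->
  exists2 j : 'M[rat]_(m, n) * rat,
    nbhs x [set z | `|z - map_mx ratr j.1| < ratr j.2] &
    [set z | `|z - map_mx ratr j.1| < ratr j.2] `<=` [set z | `|z - x| < rho].
Proof.
move=> rho0.
(* With r < rho / 2 and a centre within r / 2 of x, the ball reaches at most 3 r / 2 < rho from
   x. *)
have [r rI] := rat_in_itvoo (divr_gt0 rho0 (ltr0Sn R 1)).
have /andP[r0 r1] : (0 : R) < ratr r < rho / 2 by move: rI; rewrite in_itv.
have ex (ij : 'I_m * 'I_n) : exists q : rat, `|x ij.1 ij.2 - ratr q| < ratr r / 2.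
  have lt : x ij.1 ij.2 - ratr r / 2 < x ij.1 ij.2 by rewrite gtrBl divr_gt0.
  have [q] := rat_in_itvoo lt; rewrite in_itv /= => /andP[q1 q2]; exists q.
  by rewrite ltr_norml; apply/andP; split; lra.
have [q qP] := choice ex.
exists (\matrix_(i, j) q (i, j), r) => /=.
  have xq : `|x - map_mx ratr (\matrix_(i, j) q (i, j))| < ratr r.
    apply: (@le_lt_trans _ _ (ratr r / 2)); last by lra.
    apply: mx_norm_leP => [|i j]; first by rewrite divr_ge0 // ltW.
    by rewrite !mxE ltW //; apply: (qP (i, j)).
  apply/nbhs_ballP; exists (ratr r - `|x - map_mx ratr (\matrix_(i, j) q (i, j))|) => /=.
    by rewrite subr_gt0.
  move=> z; rewrite mx_norm_ball /ball_ /= => xz.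
  have := ler_distD x z (map_mx ratr (\matrix_(i, j) q (i, j))).
  by rewrite (distrC z x); lra.
move=> z /=.
have : `|x - map_mx ratr (\matrix_(i, j) q (i, j))| <= ratr r / 2.
  apply: mx_norm_leP => [|i j]; first by rewrite divr_ge0 // ltW.
  by rewrite !mxE ltW //; apply: (qP (i, j)).
move: (map_mx _ _) => c xc zc.
by have := ler_distD c z x; rewrite (distrC c x); lra.
Qed.

Lemma hnull_set0 (R : realType) (m n d : nat) : (0 < d)%N -> hnull d (set0 : set 'M[R]_(m, n)).
Proof.
move=> d0 e e0; exists (fun=> 0), (fun=> 0); split=> // l.
by rewrite big1 ?ltW // => k _; rewrite expr0n gtn_eqF.
Qed.

(** Lindelöf argument: only the countably many rational balls that meet A in a null set are used,
    and every point of A lies in one of them. *)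
Lemma hnull_local (R : realType) (m n d : nat) (A : set 'M[R]_(m, n)) : (0 < d)%N ->
  (forall x, A x -> exists2 rho : R, 0 < rho & hnull d (A `&` [set z | `|z - x| < rho])) ->
  hnull d A.
Proof.
move=> d0 loc.
pose B (j : 'M[rat]_(m, n) * rat) : set 'M[R]_(m, n) := [set z | `|z - map_mx ratr j.1| < ratr j.2].
apply: (@hnull_sub _ _ _ _ _ (\bigcup_j [set x | (A `&` B j) x /\ hnull d (A `&` B j)])).
  move=> x Ax; have [rho rho0 h] := loc x Ax.
  have [j xj jx] := rational_balls x rho0.
  exists j => //; split; first by split=> //; apply: nbhs_singleton xj.
  by apply: (hnull_sub _ h) => z [Az /jx].
apply: hnull_bigcup => // j.
have [h|h] := pselect (hnull d (A `&` B j)); first by apply: (hnull_sub _ h) => x [].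
apply: (@hnull_sub _ _ _ _ _ set0); last exact: hnull_set0.
by move=> x [].
Qed.

(** Near each x, T is injective with a 2-Lipschitz inverse, so [hnull_lipschitz] applies on a ball
    and [hnull_local] glues the balls. *)
Lemma hnull_preimage (R : realType) (m n d : nat) (D Z : set 'M[R]_(m, n))
    (T : 'M[R]_(m, n) -> 'M[R]_(m, n)) : (0 < d)%N ->
  (forall x, D x -> exists2 rho : R, 0 < rho & forall x' x'',
    `|x' - x| < rho -> `|x'' - x| < rho -> `|x' - x''| <= 2 * `|T x' - T x''|) ->
  hnull d Z -> hnull d [set x | D x /\ Z (T x)].
Proof.
move=> d0 loc hZ; apply: hnull_local => // x [Dx _].
have [rho rho0 h] := loc x Dx; exists rho => //.
apply: (hnull_lipschitz (f := T) (C := 2) hZ) => [x' [[]] //|x' x'' [_ h'] [_ h'']].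
exact: h.
Qed.

(** From some time k on, the orbit stays in a rational ball around y whose trapped points are null,
    so x is in the k-th preimage of a null set; pairs of a time and a rational ball are
    countable. *)
Lemma hnull_converging (R : realType) (N M d : nat) (T : 'M[R]_(N, M) -> 'M[R]_(N, M))
    (Y : set 'M[R]_(N, M)) : (0 < d)%N ->
  (forall x, product_simplex R N M x -> product_simplex R N M (T x)) ->
  (forall x, product_simplex R N M x -> exists2 rho : R, 0 < rho & forall x' x'',
    `|x' - x| < rho -> `|x'' - x| < rho -> `|x' - x''| <= 2 * `|T x' - T x''|) ->
  (forall y, Y y -> exists2 rho : R, 0 < rho &
    hnull d (stays_near T [set x | `|x - y| < rho])) ->
  hnull d [set x | product_simplex R N M x /\
    exists2 y, Y y & (fun t : nat => iter t T x) @ \oo --> y].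
Proof.
move=> d0 TD Tlip hY.
pose B (j : 'M[rat]_(N, M) * rat) : set 'M[R]_(N, M) :=
  [set z | `|z - map_mx ratr j.1| < ratr j.2].
(* W j is empty when the trapped set of B j is not null, so that every W j is null. *)
pose W j := [set x | stays_near T (B j) x /\ hnull d (stays_near T (B j))].
have hW j : hnull d (W j).
  have [h|h] := pselect (hnull d (stays_near T (B j))).
    by apply: (hnull_sub _ h) => x [].
  apply: (@hnull_sub _ _ _ _ _ set0); last exact: hnull_set0.
  by move=> x [].
pose A k j := [set x | product_simplex R N M x /\ W j (iter k T x)].
have hA k j : hnull d (A k j).
  elim: k => [|k ih]; first by apply: (hnull_sub _ (hW j)) => x [].
  apply: (hnull_sub _ (hnull_preimage d0 Tlip ih)) => x [Dx Wx].
  by split=> //; split; [apply: TD|rewrite -iterSr].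
apply: (@hnull_sub _ _ _ _ _ (\bigcup_p A p.1 p.2)); last exact: hnull_bigcup.
move=> x [Dx [y Yy xy]].
have [rho rho0 hr] := hY y Yy.
have [j yj jy] := rational_balls y rho0.
have [k _ hk] := xy _ yj.
exists (k, j) => //; split=> //=; split.
  split; first by elim: k {hk} => //= k ih; apply: TD.
  by move=> t; rewrite -iterD; apply: hk => /=; rewrite leq_addl.
by apply: (hnull_sub _ hr) => z [Dz sz]; split=> // t; apply: jy; apply: sz.
Qed.

(** The simplex is closed in the unit cube, a product of segments carried from row vectors to
    matrices by [vec_mx]. *)
Lemma simplex_compact (R : realType) (N M : nat) : compact (product_simplex R N M).
Proof.
have box : compact ((fun v : 'rV[R]_(N * M) => vec_mx v : 'M[R]_(N, M)) @`
    [set v : 'rV[R]_(N * M) | forall k, v ord0 k \in `[0, 1]]).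
  apply: continuous_compact.
    apply: continuous_subspaceT => v A /nbhs_ballP[e /= e0 eA].
    apply/nbhs_ballP; exists e => //= u [_ vu]; apply: eA; split=> // i j.
    by rewrite !mxE; apply: vu.
  by apply: (@rV_compact R (N * M) (fun=> `[0, 1]%classic)) => _; apply: segment_compact.
apply: (subclosed_compact _ box).
- move=> x /= clx.
  have near (e : R) : 0 < e -> exists2 z, product_simplex R N M z & `|z - x| <= e.
    move=> e0; have [z [Dz]] := clx _ (nbhsx_ballx x e e0).
    by rewrite mx_norm_ball /ball_ /= distrC => /ltW; exists z.
  split=> [i j|i].
    apply/ler_addgt0Pr => e e0; have [z [z0 _] zx] := near e e0.
    have := le_trans (mx_coord_le _ i j) zx; rewrite !mxE ler_norml => /andP[_].
    by have := z0 i j; lra.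
  apply/eqP; rewrite -subr_eq0 -normr_le0; apply/ler_addgt0Pr => e e0; rewrite add0r.
  have e0' : 0 < e / M.+1%:R by apply: divr_gt0.
  have [z [_ sz] zx] := near _ e0'; rewrite -(sz i) -sumrB.
  apply: le_trans (ler_norm_sum _ _ _) _.
  apply: (@le_trans _ _ (\sum_(j < M) e / M.+1%:R)).
    apply: ler_sum => j _; rewrite distrC.
    by have := le_trans (mx_coord_le _ i j) zx; rewrite !mxE.
  rewrite sumr_const card_ord -[leLHS]mulr_natr -mulrA ger_pMr // mulrC ler_pdivrMr //.
  by rewrite mul1r ler_nat leqnSn.
- move=> x Dx; exists (mxvec x); last by rewrite mxvecK.
  move=> k; case/mxvec_indexP: k => i j; rewrite mxvecE in_itv /= simplex_le1 // andbT.
  by have [+ _] := Dx; apply.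
Qed.

Lemma simplex_bounded (R : realType) (N M : nat) (f : 'M[R]_(N, M) -> R) :
  (forall x, product_simplex R N M x -> {for x, continuous f}) ->
  exists2 C : R, 0 <= C & forall x, product_simplex R N M x -> `|f x| <= C.
Proof.
move=> cf.
have /compact_bounded[C [_ hC]] : compact (f @` product_simplex R N M).
  apply: continuous_compact (@simplex_compact R N M).
  by apply: continuous_in_subspaceT => x; rewrite inE => /cf.
exists (`|C| + 1) => [|x Dx]; first by rewrite addr_ge0.
apply: (hC (`|C| + 1)); first by rewrite (le_lt_trans (ler_norm C)) // ltrDl.
by exists x.
Qed.

(** * The multiplicative weights update map *)

Section WeightedForm.
Variables (R : realType) (m n : nat).
Implicit Types (w : 'I_m -> 'I_n -> R) (u v : 'M[R]_(m, n)).

(** Serves with two weights: positive ones give an inner product, the indicator of the zero entries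
    of y gives a seminorm blind to the support of y. *)
Definition wform w u v : R := \sum_i \sum_j w i j * (u i j * v i j).

Lemma wform_bil w : bil (wform w).
Proof.
split=> a u v z; rewrite /wform mulr_sumr -big_split; apply: eq_bigr => i _;
  rewrite mulr_sumr -big_split; apply: eq_bigr => j _ /=; rewrite !mxE; ring.
Qed.

Lemma wformC w u v : wform w u v = wform w v u.
Proof. by apply: eq_bigr => i _; apply: eq_bigr => j _; rewrite [u i j * _]mulrC. Qed.

Lemma wform_ge w u : (forall i j, 0 <= w i j) -> forall i j,
  w i j * u i j ^+ 2 <= wform w u u.
Proof.
move=> w0 i j; have t0 k l : 0 <= w k l * (u k l * u k l).
  by apply: mulr_ge0 => //; rewrite -expr2; apply: sqr_ge0.
rewrite /wform (bigD1 i) //= (bigD1 j) //= expr2 -addrA lerDl addr_ge0 //.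
  exact: sumr_ge0.
by apply: sumr_ge0 => k _; apply: sumr_ge0.
Qed.

Lemma wform_ge0 w u : (forall i j, 0 <= w i j) -> 0 <= wform w u u.
Proof.
move=> w0; apply: sumr_ge0 => i _; apply: sumr_ge0 => j _.
by apply: mulr_ge0 => //; rewrite -expr2; apply: sqr_ge0.
Qed.

Lemma sqr_norm_le u (C X : R) : 0 <= X -> (forall i j, C * u i j ^+ 2 <= X) ->
  C * `|u| ^+ 2 <= X.
Proof.
move=> X0 h; have [u0|/mx_norm_neq0[[i j] /= E]] := eqVneq (mx_norm u) 0.
  by rewrite [`|u|]u0 expr0n mulr0.
by rewrite [`|u|]E real_normK ?num_real.
Qed.

End WeightedForm.

Lemma sdiff_affine (R : realType) (m n : nat) (f : 'M[R]_(m, n) -> R) (c : R) y F :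
  sdiff f y F -> sdiff (fun x => 1 + c * f x) y (c *: F).
Proof.
move=> hf; have := sdiffD (sdiff_cst 1 y) (sdiffM (sdiff_cst c y) hf).
by rewrite scaler0 addr0 add0r.
Qed.

Section Mwu.
Variables (R : realType) (N M : nat) (P : 'M[R]_(N, M) -> R) (U : set 'M[R]_(N, M)).
Hypotheses (oU : open U) (DU : product_simplex R N M `<=` U) (C2P : C2_on U P).

Local Notation D := (product_simplex R N M).

Definition hess_row (x : 'M[R]_(N, M)) i j : 'M[R]_(N, M) :=
  \matrix_(k, l) partial k l (partial i j P) x.

Definition hess_mul (x v : 'M[R]_(N, M)) i j : R := mxdot (hess_row x i j) v.

Lemma sdiff_partial x i j : D x -> sdiff (partial i j P) x (hess_row x i j).
Proof. by move=> /DU Ux; apply: C1_sdiff oU Ux _; have [_] := C2P; apply. Qed.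

Lemma partials_bounded : exists2 B : R, 0 <= B & forall x, D x ->
  (forall i j, `|partial i j P x| <= B) /\
  (forall i j k l, `|partial k l (partial i j P) x| <= B).
Proof.
have [h1 h2] := C2P.
have b1 (ij : 'I_N * 'I_M) : exists C : R, 0 <= C /\
    forall x, D x -> `|partial ij.1 ij.2 P x| <= C.
  by have [|C C0 hC] := @simplex_bounded R N M (partial ij.1 ij.2 P);
    [move=> x /DU Ux; have [] := h1 x Ux ij.1 ij.2|exists C].
have b2 (q : ('I_N * 'I_M) * ('I_N * 'I_M)) : exists C : R, 0 <= C /\
    forall x, D x -> `|partial q.2.1 q.2.2 (partial q.1.1 q.1.2 P) x| <= C.
  by have [|C C0 hC] := @simplex_bounded R N M (partial q.2.1 q.2.2 (partial q.1.1 q.1.2 P));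
    [move=> x /DU Ux; have [] := h2 q.1.1 q.1.2 x Ux q.2.1 q.2.2|exists C].
have [C1 hC1] := choice b1; have [C2 hC2] := choice b2.
have s1 : 0 <= \sum_q C1 q by apply: sumr_ge0 => q _; have [] := hC1 q.
have s2 : 0 <= \sum_q C2 q by apply: sumr_ge0 => q _; have [] := hC2 q.
exists (\sum_q C1 q + \sum_q C2 q); first exact: addr_ge0.
move=> x Dx; split=> [i j|i j k l].
  have [_ /(_ x Dx) h] := hC1 (i, j); apply: le_trans h _.
  rewrite (bigD1 (i, j)) //= -addrA lerDl addr_ge0 //.
  by apply: sumr_ge0 => q _; have [] := hC1 q.
have [_ /(_ x Dx) h] := hC2 ((i, j), (k, l)); apply: le_trans h _.
rewrite addrC (bigD1 ((i, j), (k, l))) //= -addrA lerDl addr_ge0 //.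
by apply: sumr_ge0 => q _; have [] := hC2 q.
Qed.

Lemma hess_mul_sym x (u v : 'M[R]_(N, M)) : D x ->
  \sum_i \sum_j hess_mul x u i j * v i j = \sum_i \sum_j hess_mul x v i j * u i j.
Proof.
move=> Dx; have Ux := DU Dx.
have E a b : \sum_i \sum_j hess_mul x a i j * b i j =
    \sum_(q : 'I_N * 'I_M) \sum_(r : 'I_N * 'I_M)
      partial r.1 r.2 (partial q.1 q.2 P) x * a r.1 r.2 * b q.1 q.2.
  rewrite pair_bigA; apply: eq_bigr => -[i j] _ /=.
  rewrite /hess_mul /mxdot pair_bigA mulr_suml; apply: eq_bigr => -[k l] _ /=.
  by rewrite mxE.
rewrite !E exchange_big; apply: eq_bigr => q _; apply: eq_bigr => r _ /=.
by rewrite (clairaut _ _ _ _ oU Ux C2P) mulrAC.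
Qed.

Lemma hessian_formE x (v : 'M[R]_(N, M)) : D x ->
  hessian_form P x v = \sum_i \sum_j hess_mul x v i j * v i j.
Proof.
move=> Dx; have Ux := DU Dx.
apply: eq_bigr => i _; apply: eq_bigr => j _.
rewrite /hess_mul /mxdot mulr_suml; apply: eq_bigr => k _.
rewrite mulr_suml; apply: eq_bigr => l _.
by rewrite mxE (clairaut _ _ _ _ oU Ux C2P); ring.
Qed.

(** * Small stepsizes and the Jacobian of the update *)

Variables (B eps : R).
Hypotheses (B0 : 0 <= B) (eps0 : 0 < eps).
Hypothesis pB : forall x, D x -> forall i j, `|partial i j P x| <= B.
Hypothesis hB : forall x, D x -> forall i j k l, `|partial k l (partial i j P) x| <= B.
Let H1 := N%:R * M%:R * B.
(** The first three summands bound the terms of J v - v coming from the derivative of the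
    denominator, the derivative of the numerator, and the quotient minus 1; 4 B also yields eps B <=
    1 / 16. The last summand makes 1 + S positive at a stationary point. *)
Hypothesis eps_small : eps * (3 * (H1 + M%:R * B) + 2 * H1 + 4 * B + N%:R * M%:R * H1) <= 1 / 4.

Let nm0 : 0 <= N%:R * M%:R :> R. Proof. exact: mulr_ge0. Qed.
Let H10 : 0 <= H1. Proof. exact: mulr_ge0. Qed.

Local Notation T := (mwu P (fun=> eps)).
Local Notation num x i j := (1 + eps * partial i j P x).
Local Notation den x i := (1 + eps * avg_partial P x i).

Lemma avg_le x i : D x -> `|avg_partial P x i| <= B.
Proof.
move=> Dx; have [x0 sx] := Dx.
apply: le_trans (ler_norm_sum _ _ _) _; rewrite -[B]mul1r -(sx i) mulr_suml.
by apply: ler_sum => j _; rewrite normrM (ger0_norm (x0 i j)) ler_wpM2l // pB.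
Qed.

Lemma eps_parts : [/\ eps * B <= 1 / 16, 0 <= eps * H1, 0 <= eps * (M%:R * B),
  0 <= eps * (N%:R * M%:R * H1) & 0 <= eps * B].
Proof.
have e0 := ltW eps0.
have a1 : 0 <= eps * H1 by apply: mulr_ge0.
have a2 : 0 <= eps * (M%:R * B) by apply: mulr_ge0 => //; apply: mulr_ge0.
have a3 : 0 <= eps * (N%:R * M%:R * H1) by apply: mulr_ge0 => //; apply: mulr_ge0.
have a4 : 0 <= eps * B by apply: mulr_ge0.
have E h b k : eps * (3 * (h + b) + 2 * h + 4 * B + k) =
  5 * (eps * h) + 3 * (eps * b) + 4 * (eps * B) + eps * k by ring.
by split=> //; move: eps_small; rewrite E; lra.
Qed.

Lemma near1 (a : R) : `|a| <= B -> 15 / 16 <= 1 + eps * a <= 17 / 16.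
Proof.
move=> aB; have [eB _ _ _ _] := eps_parts.
have : `|eps * a| <= eps * B by rewrite normrM gtr0_norm // ler_pM2l.
by rewrite ler_norml => /andP[? ?]; apply/andP; split; lra.
Qed.

Lemma num_bounds x i j : D x -> 15 / 16 <= num x i j <= 17 / 16.
Proof. by move=> Dx; apply/near1/pB. Qed.

Lemma den_bounds x i : D x -> 15 / 16 <= den x i <= 17 / 16.
Proof. by move=> Dx; apply/near1/avg_le. Qed.

Lemma num_gt0 x i j : D x -> 0 < num x i j.
Proof. by move=> /(num_bounds i j)/andP[h _]; apply: lt_le_trans h; lra. Qed.

Lemma den_gt0 x i : D x -> 0 < den x i.
Proof. by move=> /(den_bounds i)/andP[h _]; apply: lt_le_trans h; lra. Qed.

Lemma mwu_admissible : admissible_stepsizes P (fun=> eps).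
Proof.
by split=> // x Dx i; split=> [j|]; [apply: num_gt0|apply: den_gt0].
Qed.

(** Weighted by x i j, the numerators of row i sum to its denominator. *)
Lemma mwu_simplex x : D x -> D (T x).
Proof.
move=> Dx; have [x0 sx] := Dx; split=> [i j|i].
  by rewrite mxE mulr_ge0 // divr_ge0 // ltW // ?num_gt0 ?den_gt0.
under eq_bigr do rewrite mxE mulrA.
rewrite -mulr_suml; apply/eqP; rewrite mulrC -(inj_eq (mulfI (lt0r_neq0 (den_gt0 i Dx)))).
rewrite mulVKf ?lt0r_neq0 ?den_gt0 // mulr1; apply/eqP.
under eq_bigr do rewrite mulrDr mulr1 mulrCA.
by rewrite big_split /= sx -mulr_sumr.
Qed.

Definition avg_grad (x : 'M[R]_(N, M)) i : 'M[R]_(N, M) :=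
  \sum_s (x i s *: hess_row x i s + partial i s P x *: delta_mx i s).

(** Left in the unsimplified shape that [sdiffM] and [sdiffV] produce. *)
Definition mwu_grad (x : 'M[R]_(N, M)) i j : 'M[R]_(N, M) :=
  x i j *: (num x i j *: (- den x i ^- 2 *: (eps *: avg_grad x i))
            + (den x i)^-1 *: (eps *: hess_row x i j))
  + (num x i j / den x i) *: delta_mx i j.

Lemma sdiff_mwu x i j : D x -> sdiff (fun z => T z i j) x (mwu_grad x i j).
Proof.
move=> Dx.
have hA : sdiff (fun z => avg_partial P z i) x (avg_grad x i).
  apply: sdiff_sum => s; apply: sdiffM; first exact: sdiff_coord.
  exact: sdiff_partial.
have hd := sdiffV (lt0r_neq0 (den_gt0 i Dx)) (sdiff_affine eps hA).
have hn := sdiff_affine eps (sdiff_partial i j Dx).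
have := sdiffM (sdiff_coord i j x) (sdiffM hn hd).
by congr (sdiff _ _ _); apply: funext => z; rewrite mxE.
Qed.

Definition avg_der (x v : 'M[R]_(N, M)) i : R :=
  \sum_s (x i s * hess_mul x v i s + partial i s P x * v i s).

Lemma mwu_jacobianE x v i j : jacobian_map (mwu_grad x) v i j =
  x i j * (num x i j * (- den x i ^- 2 * (eps * avg_der x v i))
            + (den x i)^-1 * (eps * hess_mul x v i j))
  + num x i j / den x i * v i j.
Proof.
rewrite mxE /mwu_grad mxdotDl mxdotZl mxdotDl !mxdotZl mxdot_delta mxdot_suml.
congr (_ * (_ * (_ * (_ * _)) + _) + _).
by apply: eq_bigr => s _; rewrite mxdotDl !mxdotZl mxdot_delta.
Qed.

Lemma hess_mul_le x v i j : D x -> `|hess_mul x v i j| <= H1 * `|v|.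
Proof.
move=> Dx; apply: le_trans (mxdot_le _ _) _; apply: ler_wpM2r => //.
apply: (@le_trans _ _ (\sum_(k < N) \sum_(l < M) B)).
  by apply: ler_sum => k _; apply: ler_sum => l _; rewrite mxE; apply: hB.
by rewrite !sumr_const !card_ord /H1 -mulrnA -[leLHS]mulr_natl mulnC natrM.
Qed.

Lemma avg_hess_le x v i : D x -> `|\sum_s x i s * hess_mul x v i s| <= H1 * `|v|.
Proof.
move=> Dx; have [x0 sx] := Dx.
apply: le_trans (ler_norm_sum _ _ _) _; rewrite -[leRHS]mul1r -(sx i) mulr_suml.
by apply: ler_sum => s _; rewrite normrM (ger0_norm (x0 i s)) ler_wpM2l // hess_mul_le.
Qed.

Lemma avg_der_le x v i : D x -> `|avg_der x v i| <= (H1 + M%:R * B) * `|v|.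
Proof.
move=> Dx; rewrite /avg_der big_split /= mulrDl; apply: le_trans (ler_normD _ _) _.
apply: lerD; first exact: avg_hess_le.
apply: le_trans (ler_norm_sum _ _ _) _.
apply: (@le_trans _ _ (\sum_(s < M) B * `|v|)).
  apply: ler_sum => s _; rewrite normrM; apply: ler_pM => //; first exact: pB.
  exact: mx_coord_le.
by rewrite sumr_const card_ord -[leLHS]mulr_natl mulrA.
Qed.

Lemma mwu_jacobian_near_id x v : D x ->
  `|jacobian_map (mwu_grad x) v - v| <= 1 / 4 * `|v|.
Proof.
move=> Dx; apply: mx_norm_leP => [|i j]; first exact: mulr_ge0.
have [x0 _] := Dx; have x1 := simplex_le1 i j Dx.
have n0 := num_gt0 i j Dx; have d0 := den_gt0 i Dx.
have /andP[_ n1] := num_bounds i j Dx; have /andP[d1 _] := den_bounds i Dx.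
have di : (den x i)^-1 <= 2.
  rewrite -[leRHS]invrK lef_pV2 ?posrE ?invr_gt0 //; apply: le_trans d1; lra.
have nd : num x i j * den x i ^- 2 <= 3.
  rewrite ler_pdivrMr ?exprn_gt0 //; apply: le_trans n1 _.
  have : (15 / 16) ^+ 2 <= den x i ^+ 2 by rewrite lerXn2r ?nnegrE // ltW.
  by rewrite expr2; lra.
have -> : (jacobian_map (mwu_grad x) v - v) i j =
    - (x i j * (num x i j * den x i ^- 2) * (eps * avg_der x v i))
    + x i j * (den x i)^-1 * (eps * hess_mul x v i j)
    + eps * (partial i j P x - avg_partial P x i) * (den x i)^-1 * v i j.
  rewrite [LHS]mxE mwu_jacobianE [(- v) i j]mxE; field; exact: lt0r_neq0.
have t1 : `|x i j * (num x i j * den x i ^- 2) * (eps * avg_der x v i)| <=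
    1 * 3 * (eps * ((H1 + M%:R * B) * `|v|)).
  rewrite normrM; apply: ler_pM => //.
    rewrite ger0_norm; first apply: ler_pM => //.
    - by rewrite divr_ge0 ?exprn_ge0 // ltW.
    - by apply: mulr_ge0 => //; rewrite divr_ge0 ?exprn_ge0 // ltW.
  by rewrite normrM gtr0_norm // ler_pM2l // avg_der_le.
have t2 : `|x i j * (den x i)^-1 * (eps * hess_mul x v i j)| <= 1 * 2 * (eps * (H1 * `|v|)).
  rewrite normrM; apply: ler_pM => //.
    rewrite ger0_norm; first apply: ler_pM => //.
    - by rewrite invr_ge0 ltW.
    - by rewrite divr_ge0 // ltW.
  by rewrite normrM gtr0_norm // ler_pM2l // hess_mul_le.
have t3 : `|eps * (partial i j P x - avg_partial P x i) * (den x i)^-1 * v i j| <=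
    eps * (B + B) * 2 * `|v|.
  rewrite normrM; apply: ler_pM => //; last exact: mx_coord_le.
  rewrite normrM normfV (gtr0_norm d0); apply: ler_pM => //.
    by rewrite invr_ge0 ltW.
  rewrite normrM gtr0_norm // ler_pM2l //; apply: le_trans (ler_normB _ _) _.
  by apply: lerD; [apply: pB|apply: avg_le].
apply: le_trans (ler_normD _ _) _; apply: le_trans (lerD (ler_normD _ _) t3) _.
rewrite normrN; apply: le_trans (lerD (lerD t1 t2) (lexx _)) _.
apply: (@le_trans _ _ ((eps * (3 * (H1 + M%:R * B) + 2 * H1 + 4 * B + N%:R * M%:R * H1)) * `|v|)).
  rewrite -subr_ge0; have -> : forall r, eps * (3 * (H1 + M%:R * B) + 2 * H1 + 4 * B + r) * `|v| -
    (1 * 3 * (eps * ((H1 + M%:R * B) * `|v|)) + 1 * 2 * (eps * (H1 * `|v|)) +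
     eps * (B + B) * 2 * `|v|) = eps * r * `|v| by move=> r; ring.
  by apply: mulr_ge0 => //; have [] := eps_parts.
exact: ler_wpM2r.
Qed.

(** The Jacobian is within 1/4 of the identity and T within 1/4 of its Jacobian, so T shrinks
    distances at most by half. *)
Lemma mwu_locally_expanding x : D x -> exists2 rho : R, 0 < rho & forall x' x'',
  `|x' - x| < rho -> `|x'' - x| < rho -> `|x' - x''| <= 2 * `|T x' - T x''|.
Proof.
move=> Dx; have q0 : (0 : R) < 1 / 4 by [].
have [rho rho0 h] := sdiff_jacobian (fun i j => sdiff_mwu i j Dx) q0.
exists rho => // x' x'' xx' xx''.
have : `|T x' - T x'' - jacobian_map (mwu_grad x) (x' - x'')| <= 1 / 4 * `|x' - x''|.
  exact: h.
have := mwu_jacobian_near_id (x' - x'') Dx.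
move: (jacobian_map (mwu_grad x) (x' - x'')) => j; move: (T x' - T x'') (x' - x'') => t w h1 h2.
have a1 : `|w| - `|t| <= `|w - t| by apply: lerB_dist.
have a2 : `|w - t| <= `|j - w| + `|t - j|.
  by rewrite [`|j - w|]distrC [`|t - j|]distrC; apply: ler_distD.
by lra.
Qed.

(** A fixed point already satisfies the KKT equalities on its support, so an inequality fails at a
    zero entry, where the update factor q exceeds 1. *)
Lemma hnull_nonstationary y : (1 < M)%N -> D y -> T y = y -> ~ stationary P y ->
  exists2 rho : R, 0 < rho & hnull (N * M.-1) (stays_near T [set x | `|x - y| < rho]).
Proof.
move=> M1 Dy Ty nst.
have fixE i j : y i j != 0 -> partial i j P y = avg_partial P y i.
  move=> yij; have := congr1 (fun z : 'M[R]_(N, M) => z i j) Ty; rewrite mxE.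
  rewrite -[RHS]mulr1 => /(mulfI yij) q1.
  have := congr1 (fun r => r * den y i) q1.
  rewrite divfK ?lt0r_neq0 ?den_gt0 // mul1r => /addrI.
  by move=> /(mulfI (lt0r_neq0 eps0)).
have [i [j [yij lt]]] : exists i j, y i j = 0 /\ avg_partial P y i < partial i j P y.
  apply: contrapT => H; apply: nst; split=> // i j.
    by move=> /lt0r_neq0 /fixE.
  by move=> yij; rewrite leNgt; apply/negP => lt; apply: H; exists i, j.
have d0 := den_gt0 i Dy.
have hA : sdiff (fun z => avg_partial P z i) y (avg_grad y i).
  apply: sdiff_sum => s; apply: sdiffM; first exact: sdiff_coord.
  exact: sdiff_partial.
have hq := sdiffM (sdiff_affine eps (sdiff_partial i j Dy))
  (sdiffV (lt0r_neq0 d0) (sdiff_affine eps hA)).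
pose q := num y i j / den y i.
have q1 : 1 < q by rewrite ltr_pdivlMr // mul1r ltrD2l ltr_pM2l.
(* By continuity the factor stays above q - (q - 1) / 2 = (1 + q) / 2 > 1 near y. *)
have e0 : 0 < (q - 1) / 2 by rewrite divr_gt0 // subr_gt0.
have [rho [h rho0]] := @filter_ex _ (0 : R)^'+ _ _
  (filterI (sdiff_cont hq e0) (nbhs_right_gt 0)).
exists rho => //; apply: (hnull_sub _ (hnull_simplex_face i j M1)) => x [Dx xW].
split=> //; apply: contrapT => /eqP xij.
have Dk k : D (iter k T x) by elim: k => //= k ih; apply: mwu_simplex.
have xij0 : 0 < x i j by rewrite lt_neqAle eq_sym xij; have [+ _] := Dx; apply.
apply: (geometric_unbounded (lambda := (1 + q) / 2) (C := 1) _ xij0); first by lra.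
move=> k; apply: le_trans (simplex_le1 i j (Dk k)); elim: k => [|k ih].
  by rewrite expr0 mul1r.
rewrite iterS [T _]/mwu mxE [leRHS]mulrC exprS -mulrA; apply: ler_pM => //.
- by lra.
- by apply: mulr_ge0; [apply: exprn_ge0; lra|apply: ltW].
by have := h _ (xW k); rewrite -/q ler_norml => /andP[+ _]; lra.
Qed.

Lemma hess_mul_lin x a u v i j :
  hess_mul x (a *: u + v) i j = a * hess_mul x u i j + hess_mul x v i j.
Proof. by rewrite /hess_mul mxdotDr mxdotZr. Qed.

(* On the directions supported in the support of y and tangent to the simplex the
   Jacobian of T is 1 + S, where S is the Hessian of P seen through the weighted
   inner product with weights [den y i / (eps * y i j)]. *)
Lemma hnull_saddle y e : (0 < M)%N -> stationary P y -> tangent e ->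
  (forall i j, y i j = 0 -> e i j = 0) -> 0 < hessian_form P y e ->
  exists2 rho : R, 0 < rho & hnull (N * M.-1) (stays_near T [set x | `|x - y| < rho]).
Proof.
move=> M0 [Dy st1 st2] te ey he; have [y0 sy] := Dy.
have d0 i : 0 < den y i by apply: den_gt0.
have dn0 i : den y i != 0 by apply: lt0r_neq0.
have e_neq0 : eps != 0 by apply: lt0r_neq0.
pose F (u : 'M[R]_(N, M)) := tangent u /\ forall i j, y i j = 0 -> u i j = 0.
pose off i j : R := (y i j == 0)%:R.
(* On the support this is, up to the row factor den / eps, the Shahshahani metric with weights 1 / y
   i j. Elsewhere 1 replaces the zero entry to keep the weight positive; elements of F vanish
   there. *)
pose w i j := den y i / (eps * (if y i j == 0 then 1 else y i j)).
pose h u i := \sum_s y i s * hess_mul y u i s.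
pose S (u : 'M[R]_(N, M)) : 'M[R]_(N, M) :=
  \matrix_(i, j) (eps * y i j / den y i * (hess_mul y u i j - h u i)).
(* Entries off the support are cleared, then the row sums are restored to zero by a multiple of y,
   whose rows sum to 1 and live on the support. *)
pose Pi (v : 'M[R]_(N, M)) : 'M[R]_(N, M) :=
  \matrix_(i, j) ((1 - off i j) * v i j - y i j * \sum_s (1 - off i s) * v i s).
have h_lin a u v i : h (a *: u + v) i = a * h u i + h v i.
  rewrite /h mulr_sumr -big_split; apply: eq_bigr => s _ /=.
  by rewrite hess_mul_lin; ring.
have lS : lin S.
  by move=> a u v; apply/matrixP => i j; rewrite !mxE hess_mul_lin h_lin; ring.
have lPi : lin Pi.
  move=> a u v; apply/matrixP => i j; rewrite !mxE.
  have -> : \sum_s (1 - off i s) * (a *: u + v) i s =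
      a * (\sum_s (1 - off i s) * u i s) + \sum_s (1 - off i s) * v i s.
    by rewrite mulr_sumr -big_split; apply: eq_bigr => s _; rewrite !mxE /=; ring.
  by ring.
have off0 i j : 0 <= off i j by rewrite ler0n.
have c00 : 0 < 15 / 16 / eps by rewrite divr_gt0.
have wc i j : 15 / 16 / eps <= w i j.
  have [y'0 y'1] : 0 < (if y i j == 0 then 1 else y i j) /\
      (if y i j == 0 then 1 else y i j) <= 1.
    case: eqVneq => [_|yij]; first by split.
    by split; [rewrite lt_neqAle eq_sym yij y0|apply: simplex_le1].
  rewrite /w ler_pdivlMr ?mulr_gt0 // mulrA divfK //.
  by have /andP[+ _] := den_bounds i Dy; nra.
have w0 i j : 0 <= w i j by apply: le_trans (wc i j); apply: ltW.
have ipdef u : 15 / 16 / eps * `|u| ^+ 2 <= wform w u u.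
  apply: sqr_norm_le => [|i j]; first exact: wform_ge0.
  by apply: le_trans (wform_ge _ w0 i j); apply: ler_wpM2r; rewrite ?sqr_ge0.
have FD a u v : F u -> F v -> F (a *: u + v).
  move=> [tu u0] [tv v0]; split; first by apply: tangentD => //; apply: tangentZ.
  by move=> i j yij; rewrite !mxE u0 // v0 // mulr0 addr0.
have FPi v : F (Pi v).
  split=> [i|i j yij].
    under eq_bigr do rewrite mxE.
    by rewrite sumrB -mulr_suml sy mul1r subrr.
  by rewrite mxE /off yij eqxx subrr !mul0r subrr.
have PiF u : F u -> Pi u = u.
  move=> [tu u0]; have E i j : (1 - off i j) * u i j = u i j.
    rewrite /off; case: eqVneq => [/u0 ->|_]; by rewrite ?mulr0 // subr0 mul1r.
  apply/matrixP => i j; rewrite mxE E; under eq_bigr do rewrite E.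
  by rewrite tu mulr0 subr0.
have FS u : F u -> F (S u).
  move=> _; split=> [i|i j yij]; last by rewrite mxE yij mulr0 mul0r mul0r.
  transitivity (eps / den y i * (h u i - (\sum_j y i j) * h u i)).
    rewrite mulr_suml -sumrB mulr_sumr; apply: eq_bigr => j _; rewrite mxE.
    by field; apply: dn0.
  by rewrite sy mul1r subrr mulr0.
(* The weights cancel the prefactor of S, and the mean h u drops out against rows of sum zero: the
   Hessian form remains. *)
have ipS u v : F v -> wform w (S u) v = \sum_i \sum_j hess_mul y u i j * v i j.
  move=> [tv v0]; apply: eq_bigr => i _.
  transitivity (\sum_j (hess_mul y u i j * v i j - h u i * v i j)).
    apply: eq_bigr => j _; rewrite mxE /w; case: eqVneq => [/v0 ->|yij].
      by rewrite !mulr0 subrr.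
    by field; rewrite e_neq0 yij dn0.
  by rewrite sumrB -mulr_sumr tv mulr0 subr0.
have Ssym u v : F u -> F v -> wform w (S u) v = wform w u (S v).
  by move=> Fu Fv; rewrite ipS // wformC ipS // hess_mul_sym.
(* The inner product is at least 15 / 16 / eps times |u|^2, while the Hessian form is at most N M H1
   |u|^2 in modulus. *)
have Spos u : F u -> 0 <= wform w u u + wform w u (S u).
  move=> Fu; rewrite (wformC w u (S u)) ipS //.
  have up : `|\sum_i \sum_j hess_mul y u i j * u i j| <= N%:R * M%:R * H1 * `|u| ^+ 2.
    apply: le_trans (ler_norm_sum _ _ _) _.
    apply: (@le_trans _ _ (\sum_(i < N) \sum_(j < M) H1 * `|u| * `|u|)).
      apply: ler_sum => i _; apply: le_trans (ler_norm_sum _ _ _) _.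
      apply: ler_sum => j _; rewrite normrM; apply: ler_pM => //; first exact: hess_mul_le.
      exact: mx_coord_le.
    rewrite !sumr_const !card_ord -mulrnA -[leLHS]mulr_natl mulnC natrM.
    by rewrite expr2 !mulrA.
  have lo : N%:R * M%:R * H1 * `|u| ^+ 2 <= 15 / 16 / eps * `|u| ^+ 2.
    apply: ler_wpM2r; first exact: sqr_ge0.
    rewrite ler_pdivlMr // mulrC.
    have [_ a1 a2 a3 a4] := eps_parts.
    have E b k g : eps * (3 * (H1 + b) + 2 * g + 4 * B + k) =
       3 * (eps * H1) + 3 * (eps * b) + 2 * (eps * g) + 4 * (eps * B) + eps * k by ring.
    by move: eps_small; rewrite E; lra.
  by move: up (ipdef u); rewrite ler_norml => /andP[? _] ?; lra.
have JF u : F u -> jacobian_map (mwu_grad y) u = u + S u.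
  move=> [tu u0]; apply/matrixP => i j; rewrite mwu_jacobianE [RHS]mxE [S u i j]mxE.
  (* The partials are constant on the support in each row, so they pair to zero with a tangent u
     supported there. *)
  have -> : avg_der y u i = h u i.
    rewrite /avg_der big_split /= -[RHS]addr0; congr (_ + _).
    transitivity (avg_partial P y i * \sum_s u i s); last by rewrite tu mulr0.
    rewrite mulr_sumr; apply: eq_bigr => s _.
    case: (eqVneq (y i s) 0) => [/u0 ->|ys]; first by rewrite !mulr0.
    by rewrite st1 // lt_neqAle eq_sym ys y0.
  case: (eqVneq (y i j) 0) => [yij|yij].
    by rewrite yij (u0 i j yij) !(mulr0, mul0r, addr0).
  have -> : partial i j P y = avg_partial P y i by rewrite st1 // lt_neqAle eq_sym yij y0.
  by field; apply: dn0.
(* At a zero entry of y the Jacobian is multiplication by num / den, which the KKT inequality bounds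
   by 1. *)
have nqJ v : tangent v ->
    wform off (jacobian_map (mwu_grad y) v) (jacobian_map (mwu_grad y) v) <= wform off v v.
  move=> _; apply: ler_sum => i _; apply: ler_sum => j _.
  rewrite /off; case: eqVneq => [yij|_]; last by rewrite !mul0r.
  rewrite !mul1r mwu_jacobianE yij mul0r add0r -!expr2 exprMn.
  apply: ler_piMl; first exact: sqr_ge0.
  have n0 := num_gt0 i j Dy.
  apply: exprn_ile1; first by rewrite divr_ge0 // ltW.
  by rewrite ler_pdivrMr // mul1r lerD2l ler_pM2l // st2.
have K00 : 0 <= (1 + M%:R) ^+ 2 :> R by apply: sqr_ge0.
(* As v has zero row sums, v - Pi v is its off-support part minus y times the row sums of that part,
   hence the factor 1 + M. *)
have nqPi v : tangent v -> `|v - Pi v| ^+ 2 <= (1 + M%:R) ^+ 2 * wform off v v.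
  move=> tv; rewrite -[leLHS]mul1r; apply: sqr_norm_le.
    by apply: mulr_ge0 => //; apply: wform_ge0.
  move=> i j; rewrite mul1r.
  pose vo : 'M[R]_(N, M) := \matrix_(k, l) (off k l * v k l).
  have oE : `|vo| ^+ 2 <= wform off v v.
    rewrite -[leLHS]mul1r; apply: sqr_norm_le => [|k l]; first exact: wform_ge0.
    apply: le_trans (wform_ge v off0 k l); rewrite mul1r mxE exprMn.
    by rewrite /off; case: eqP; rewrite ?expr1n // expr0n.
  have s1 : \sum_s (1 - off i s) * v i s = - \sum_s vo i s.
    transitivity (\sum_s (v i s - vo i s)).
      by apply: eq_bigr => s _; rewrite mxE mulrBl mul1r.
    by rewrite sumrB tv sub0r.
  have E : (v - Pi v) i j = vo i j - y i j * \sum_s vo i s.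
    rewrite [LHS]mxE [(- Pi v) i j]mxE [Pi v i j]mxE [vo i j]mxE s1; ring.
  have b1 : `|(v - Pi v) i j| <= (1 + M%:R) * `|vo|.
    rewrite E mulrDl mul1r; apply: le_trans (ler_normB _ _) _; apply: lerD.
      exact: mx_coord_le.
    rewrite normrM -[leRHS]mul1r; apply: ler_pM => //.
      by rewrite ger0_norm // simplex_le1.
    apply: le_trans (ler_norm_sum _ _ _) _.
    apply: (@le_trans _ _ (\sum_(s < M) `|vo|)).
      by apply: ler_sum => s _; apply: mx_coord_le.
    by rewrite sumr_const card_ord mulr_natl.
  apply: (@le_trans _ _ (((1 + M%:R) * `|vo|) ^+ 2)).
    rewrite -[leLHS]real_normK ?num_real //.
    by rewrite lerXn2r ?nnegrE // mulr_ge0 // addr_ge0.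
  by rewrite exprMn ler_wpM2l.
have Fe : F e by [].
have eSe : 0 < wform w e (S e) by rewrite wformC ipS // -hessian_formE.
have nqe : wform off e e = 0.
  rewrite /wform big1 // => i _; rewrite big1 // => j _; rewrite /off.
  by case: eqVneq => [/ey ->|_]; rewrite ?mul0r // !mulr0.
have [b [lambda [c [bb l1 c0 be ex]]]] := expanded_form (wform_bil w) (wform_bil off)
  lS lPi (jacobian_map_lin (mwu_grad y)) (wformC w) c00 ipdef (fun v => wform_ge0 v off0)
  K00 FD FPi PiF FS Ssym Spos JF nqJ nqPi Fe eSe nqe.
exact: (@expanding_form_null R N M T y e (mwu_grad y) b lambda c M0 mwu_simplex
  (fun i j => sdiff_mwu i j Dy) bb l1 c0 te be ex).
Qed.

Lemma hnull_not_second_order y : (1 < M)%N -> D y -> T y = y ->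
  ~ second_order_stationary P y ->
  exists2 rho : R, 0 < rho & hnull (N * M.-1) (stays_near T [set x | `|x - y| < rho]).
Proof.
move=> M1 Dy Ty nso; have [st|nst] := pselect (stationary P y); last exact: hnull_nonstationary.
have [e [te ey he]] : exists e, [/\ tangent e, forall i j, y i j = 0 -> e i j = 0
    & 0 < hessian_form P y e].
  apply: contrapT => H; apply: nso; split=> // e te ey.
  by rewrite leNgt; apply/negP => he; apply: H; exists e.
exact: hnull_saddle (ltnW M1) st te ey he.
Qed.

Lemma bad_initial_conditions_null : (0 < N)%N -> (1 < M)%N ->
  null_in_simplex (bad_initial_conditions P (fun=> eps)).
Proof.
move=> N0 M1; apply: hnull_null_in_simplex.
have d0 : (0 < N * M.-1)%N by rewrite muln_gt0 N0 -ltnS prednK // ltnW.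
have := hnull_converging (Y := [set y | [/\ D y, T y = y & ~ second_order_stationary P y]])
  d0 mwu_simplex mwu_locally_expanding.
move=> H; apply: (hnull_sub _ (H _)).
  by move=> x [Dx [y [Dy Ty nso xy]]]; split=> //; exists y.
by move=> y [Dy Ty nso]; apply: hnull_not_second_order.
Qed.

End Mwu.

(** With one column the simplex is a single point and 0 is its only tangent direction. *)
Lemma second_order_stationary_dim0 (R : realType) (N : nat) (P : 'M[R]_(N, 1) -> R) y :
  product_simplex R N 1 y -> second_order_stationary P y.
Proof.
move=> Dy; have [y0 sy] := Dy.
have y1 i j : y i j = 1 by rewrite -(sy i) big_ord1 (ord1 j).
have avg i j : avg_partial P y i = partial i j P y.
  by rewrite /avg_partial big_ord1 y1 mul1r (ord1 j).
split; first by split=> // i j; rewrite (avg i j).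
move=> v tv _; have -> : v = 0.
  by apply/matrixP => i j; have := tv i; rewrite big_ord1 (ord1 j) mxE.
rewrite /hessian_form big1 // => i _; rewrite big1 // => j _; rewrite big1 // => k _.
by rewrite big1 // => l _; rewrite mxE !mul0r.
Qed.


Theorem theorem1p3 (R : realType) (N M : nat) (hN : (0 < N)%N) (hM : (0 < M)%N)
  (P : 'M[R]_(N, M) -> R) (U : set 'M[R]_(N, M)) (hU : open U)
  (hDU : product_simplex R N M `<=` U) (hP : C2_on U P) :
  exists eps : 'I_N -> R,
    admissible_stepsizes P eps /\
    null_in_simplex (bad_initial_conditions P eps).
Proof.
have [B B0 hB] := partials_bounded hDU hP.
have pB x (Dx : product_simplex R N M x) := (hB x Dx).1.
have hpB x (Dx : product_simplex R N M x) := (hB x Dx).2.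
pose H1 := N%:R * M%:R * B.
pose Z := 3 * (H1 + M%:R * B) + 2 * H1 + 4 * B + N%:R * M%:R * H1.
have H10 : 0 <= H1 by do 2 apply: mulr_ge0 => //.
have Z0 : 0 <= Z.
  by rewrite !addr_ge0 ?mulr_ge0 ?addr_ge0 ?mulr_ge0.
have Z1 : 0 < 4 * (Z + 1) by apply: mulr_gt0 => //; apply: ltr_wpDl.
(* Z vanishes if B does; the + 1 keeps the quotient meaningful. *)
pose eps := 1 / (4 * (Z + 1)).
have eps0 : 0 < eps by apply: divr_gt0.
have epsZ : eps * Z <= 1 / 4.
  by rewrite mulrAC mul1r ler_pdivrMr //; lra.
exists (fun=> eps); split; first exact: (mwu_admissible B0 eps0 pB epsZ).
(* M = 1 is separate: in dimension 0 every ball costs r ^+ 0 = 1, so [hnull] fails even for the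
   empty set. *)
have [M1|] := ltnP 1 M.
  exact: (bad_initial_conditions_null hU hDU hP B0 eps0 pB hpB epsZ hN M1).
move=> Mle1; have M1 : M = 1%N by apply/eqP; rewrite eqn_leq Mle1 hM.
have -> : bad_initial_conditions P (fun=> eps) = set0.
  rewrite -subset0 => x [_ [y [Dy _ nso _]]]; apply: nso.
  by move: P y Dy {hP hDU hU hB pB hpB U x}; rewrite M1 => P y; apply: second_order_stationary_dim0.
by move=> c; rewrite image_set0 lebesgue_outer_set0.
Qed.
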